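(* Let $(\mathcal X,\rho,\mu)$ be a space of homogeneous type with constants $K_1,K_2$, equipped with a dyadic filtration $\{\mathbb C_n\}_{n\in\mathbb Z}$. Let $p,q\in(1,\infty)$, $\varepsilon>0$, $K_0\ge1$, $w\in A_q$, and $[w]_{A_q}\le K_0$. Write $\omega(A)=\int_A w\,d\mu$. Suppose that $f,g,v\in L_p(w\,d\mu)$, $|f|\le v$, and for each $n\in\mathbb Z$ and $Q\in\mathbb C_n$ there exists a measurable function $f^Q$ on $Q$ (integrable on $Q$, so that its average is defined) such that $|f|\le f^Q\le v$ on $Q$ and $$\frac1{\mu(Q)}\int_Q|f^Q(x)-(f^Q)_Q|\,\mu(dx)\le g(y)\qquad\forall\,y\in Q,$$ where $(f^Q)_Q=\frac1{\mu(Q)}\int_Qf^Q\,d\mu$. Then there exist $\beta>0$ and $N>0$, depending only on $K_1,K_2,p,q,K_0$, such that the following hold. (i) When $\mu(\mathcal X)<\infty$, $$\|f\|^p_{L_p(w\,d\mu)}\le N\|g\|^\beta_{L_p(w\,d\mu)}\|v\|^{p-\beta}_{L_p(w\,d\mu)}+N(\mu(\mathcal X))^{-p}\,\omega(\operatorname{supp}v)\,\|v\|^p_{L_1(\mu)}.$$ If in addition $\operatorname{supp}v\subset B_{r_0}(x_0)$ and $\mu(B_{r_0}(x_0))\le\varepsilon\mu(\mathcal X)$ for some $r_0\in(0,\infty]$ and $x_0\in\mathcal X$, then $$\|f\|^p_{L_p(w\,d\mu)}\le N\|g\|^\beta_{L_p(w\,d\mu)}\|v\|^{p-\beta}_{L_p(w\,d\mu)}+N\varepsilon^p\|v\|^p_{L_p(w\,d\mu)}.$$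 (ii) When $\mu(\mathcal X)=\infty$, $$\|f\|^p_{L_p(w\,d\mu)}\le N\|g\|^\beta_{L_p(w\,d\mu)}\|v\|^{p-\beta}_{L_p(w\,d\mu)}.$$
   Context: Space of homogeneous type: $\mathcal X$ is a set with a quasi-metric $\rho$, i.e. a nonnegative symmetric function with $\rho(x,y)=0$ iff $x=y$ and $\rho(x,y)\le K_1(\rho(x,z)+\rho(z,y))$; $B_r(x)=\{y:\rho(x,y)<r\}$; balls are assumed open; $\mu$ is a complete Borel measure on a $\sigma$-algebra containing all balls, with $0<\mu(B_{2r}(x))\le K_2\mu(B_r(x))<\infty$ for all $x\in\mathcal X$, $r>0$; the Lebesgue differentiation theorem is assumed to hold in $(\mathcal X,\mu)$. Dyadic filtration (exists by Christ's theorem): for each $n\in\mathbb Z$ a collection $\mathbb C_n=\{Q^n_\alpha:\alpha\in I_n\}$ of disjoint open subsets of $\mathcal X$ such that (1) $\mu(\mathcal X\setminus\bigcup_\alpha Q^n_\alpha)=0$; (2) for each $n$ and $\alpha\in I_n$ there is a unique $\beta\in I_{n-1}$ with $Q^n_\alpha\subset Q^{n-1}_\beta$; (3) $\operatorname{diam}(Q^n_\alpha)\le N_0\delta^n$; (4) each $Q^n_\alpha$ contains some ball $B_{\varepsilon_0\delta^n}(z^n_\alpha)$; here $\delta\in(0,1)$, $\varepsilon_0>0$, $N_0$ depend only on $K_1,K_2$. For $p\in(1,\infty)$, $A_p$ is the set of nonnegative measurable $w$ on $\mathcal X$ with $$[w]_{A_p}=\sup_{x_0\in\mathcal X,r>0}\Big(\frac1{\mu(B_r(x_0))}\int_{B_r(x_0)}w\,d\mu\Big)\Big(\frac1{\mu(B_r(x_0))}\int_{B_r(x_0)}w^{-1/(p-1)}\,d\mu\Big)^{p-1}<\infty$$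 (in particular $w>0$ a.e.). $\|f\|_{L_p(w\,d\mu)}^p=\int|f|^pw\,d\mu$. *)

(* Defs.v *)
From HB Require Import structures.
From mathcomp Require Import all_boot all_order all_algebra.
From mathcomp Require Import all_classical all_reals all_analysis.
Set Implicit Arguments.
Unset Strict Implicit.
Unset Printing Implicit Defensive.
Import Order.TTheory GRing.Theory Num.Theory.
Import numFieldNormedType.Exports.
Local Open Scope classical_set_scope.
Local Open Scope ring_scope.

Section QuasiMetric.
Context {R : realType} {T : Type}.
Implicit Types (rho : T -> T -> R) (x : T) (A U : set T).

Definition quasi_metric (K1 : R) rho : Prop :=
  [/\ forall x y, 0 <= rho x y,
      forall x y, rho x y = rho y x,
      forall x y, rho x y = 0 <-> x = y &
      forall x y z, rho x y <= K1 * (rho x z + rho z y)].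

(* The radius is extended so that [qball rho x +oo] is the whole space. *)
Definition qball rho x (r : \bar R) : set T := [set y | ((rho x y)%:E < r)%E].

(* The topology induced by a quasi-metric; its balls need not be open. *)
Definition qopen rho U : Prop :=
  forall x, U x -> exists r : R, 0 < r /\ qball rho x r%:E `<=` U.

Definition qclosure rho A : set T :=
  [set x | forall U, qopen rho U -> U x -> U `&` A !=set0].

Definition qsupp rho (v : T -> R) : set T := qclosure rho [set x | v x != 0].

Definition qdiam rho A : \bar R :=
  ereal_sup [set (rho xy.1 xy.2)%:E | xy in A `*` A].

End QuasiMetric.

Section HomogeneousType.
Context {R : realType} {d : measure_display} {T : measurableType d}.
Implicit Types (rho : T -> T -> R) (mu : {measure set T -> \bar R}).

(* Meaningful for f integrable on A and 0 < mu A < +oo. *)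
Definition average mu (A : set T) (f : T -> R) : R :=
  (fine (mu A))^-1 * \int[mu]_(x in A) f x.

Definition lebesgue_differentiation_property rho mu : Prop :=
  forall f : T -> R, measurable_fun setT f ->
    (forall x (r : R), 0 < r ->
       mu.-integrable (qball rho x r%:E) (EFin \o f)) ->
    {ae mu, forall x,
      average mu (qball rho x r%:E) f @[r --> 0^'+] --> f x}.

(* Balls are open, hence measurable by the Borel condition. *)
Record homogeneous_type (K1 K2 : R) rho mu : Prop := HomogeneousType {
  ht_quasi_metric : quasi_metric K1 rho ;
  ht_open_ball : forall x (r : R), 0 < r -> qopen rho (qball rho x r%:E) ;
  ht_borel : forall U, qopen rho U -> measurable U ;
  ht_complete : measure_is_complete mu ;
  ht_doubling : forall x (r : R), 0 < r ->
    [/\ (0 < mu (qball rho x (2 * r)%:E))%E,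
        (mu (qball rho x (2 * r)%:E) <= K2%:E * mu (qball rho x r%:E))%E &
        (K2%:E * mu (qball rho x r%:E) < +oo)%E] ;
  ht_lebesgue : lebesgue_differentiation_property rho mu }.

Record dyadic_filtration (delta eps0 N0 : R) rho mu
    (C : int -> set (set T)) : Prop := DyadicFiltration {
  df_open : forall n Q, C n Q -> qopen rho Q ;
  df_disjoint : forall n, trivIset (C n) id ;
  df_cover : forall n, mu (~` \bigcup_(Q in C n) Q) = 0%E ;
  df_parent : forall n Q, C n Q ->
    exists! P : set T, C (n - 1) P /\ Q `<=` P ;
  df_diam : forall n Q, C n Q -> (qdiam rho Q <= (N0 * delta ^ n)%:E)%E ;
  df_ball : forall n Q, C n Q ->
    exists z, qball rho z (eps0 * delta ^ n)%:E `<=` Q }.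

(* w ^ (- 1 / (p - 1)) is computed in the extended reals, so that it is +oo
   where w vanishes (the real power would give 0 there). *)
Definition Ap_const rho mu (p : R) (w : T -> R) : \bar R :=
  ereal_sup
    [set (let B := qball rho xr.1 xr.2%:E in
          ((mu B)^-1 * \int[mu]_(x in B) (w x)%:E) *
          ((mu B)^-1 * \int[mu]_(x in B) ((w x)%:E^-1 `^ (p - 1)^-1))
            `^ (p - 1))%E
    | xr in [set xr : T * R | 0 < xr.2]].

(* The a.e. positivity excludes w = 0, for which the product above is
   0 * +oo = 0. *)
Definition Ap_weight rho mu (p : R) (w : T -> R) : Prop :=
  [/\ measurable_fun setT w, forall x, 0 <= w x,
      {ae mu, forall x, 0 < w x} & (Ap_const rho mu p w < +oo)%E].

Definition wmeas mu (w : T -> R) (A : set T) : \bar R :=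
  (\int[mu]_(x in A) (w x)%:E)%E.

Definition wnorm mu (w : T -> R) (p : R) (f : T -> R) : \bar R :=
  ((\int[mu]_x (`|f x| `^ p * w x)%:E) `^ p^-1)%E.

Definition wLp mu (w : T -> R) (p : R) (f : T -> R) : Prop :=
  measurable_fun setT f /\ (wnorm mu w p f < +oo)%E.

End HomogeneousType.

(* Main.v *)
(*
  Fix [l > 0] and call a dyadic cube dense if the set [v > l / 4] fills at least
  a fraction [1 / (2 D)] of it, [D] being the dyadic doubling constant of [mu].
  The maximal dense cubes cover [v > l / 4] up to a null set, and maximality
  makes [v <= l / 4] on at least half of each of them.  On such a cube [Q] the
  function [f^Q] is then [<= l / 4] on half of [Q] and [> l] on [|f| > l], so its
  mean oscillation is at least [l / 8] times the density of [|f| > l] in [Q],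
  whatever its average is.  Hence, unless [g > gam * l] on all of [Q], the set
  [|f| > l] has small density in [Q], and the A_infinity property of [w] turns
  this into a small fraction of [omega(Q)].  Since dense cubes satisfy
  [omega(Q) <= c * omega(Q & {v > l / 4})], summing over [Q] gives
    [omega(|f| > l) <= c kap^k omega(v > l / 4) + omega(|g| > gam_k l)],
  with [gam_k = (2 D)^-k / 16].  Summing over dyadic levels [l] and optimizing
  [k] yields the interpolation inequality; no maximal function is needed and
  [p] is unrelated to the class [A_q].  Maximal dense cubes exist because
  [omega(X) = +oo] when [mu X = +oo]; when [mu X < +oo], [X] is itself a cube and
  may be dense, which is harmless as long as [v <= l / 4] on half of [X].  The
  levels [l] where this fails are at most [8 ||v||_1 / mu X] and give the
  additional term.
*)
Require Import Defs.
From HB Require Import structures.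
From mathcomp Require Import all_boot all_order all_algebra.
From mathcomp Require Import all_classical all_reals all_analysis.
From mathcomp Require Import measurable_realfun ring lra.
Import Order.TTheory GRing.Theory Num.Theory.
Import numFieldNormedType.Exports.
Local Open Scope classical_set_scope.
Local Open Scope ring_scope.
Set Implicit Arguments.
Unset Strict Implicit.

(** * Measure-theoretic preliminaries *)

Section DensityMeasure.
Context {d : measure_display} {T : measurableType d} {R : realType}.
Variables (mu : {measure set T -> \bar R}) (w : T -> R).
Hypotheses (mw : measurable_fun setT w) (w0 : forall x, 0 <= w x).

(** The two proofs are arguments so that a measure structure can be attached to the function. *)
Definition density_measure of measurable_fun setT w & (forall x, 0 <= w x) :=
  fun A : set T => (\int[mu]_(x in A) (w x)%:E)%E.

Let dm := density_measure mw w0.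

Let dm0 : dm set0 = 0%E.
Proof. by rewrite /dm /density_measure integral_set0. Qed.

Let dm_ge0 A : (0 <= dm A)%E.
Proof. by apply: integral_ge0 => x _; rewrite lee_fin. Qed.

Let dm_sigma : semi_sigma_additive dm.
Proof.
move=> F mF tF mUF; rewrite /dm /density_measure ge0_integral_bigcup//.
- apply: is_cvg_ereal_nneg_natsum_cond => n _ _; exact: dm_ge0.
- apply/measurable_EFinP; exact: measurable_funTS.
- by move=> x _; rewrite lee_fin.
Qed.

HB.instance Definition _ := isMeasure.Build _ T R dm dm0 dm_ge0 dm_sigma.

Lemma exists_density_measure : exists om : {measure set T -> \bar R},
  forall A, om A = (\int[mu]_(x in A) (w x)%:E)%E.
Proof. by exists dm. Qed.

End DensityMeasure.

Lemma measurable_superlevel {d} {T : measurableType d} {R : realType}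
    (u : T -> R) (l : R) : measurable_fun setT u -> measurable [set x | l < u x].
Proof.
move=> m_u; rewrite (_ : [set x | _] = setT `&` u @^-1` `]l, +oo[%classic).
  by apply: m_u => //; exact: measurable_itv.
by rewrite setTI; apply/seteqP; split => x /=; rewrite in_itv/= andbT.
Qed.

(* Re-indexing by nat lets empty sets in, whence the first alternative. *)
Lemma countable_family_seq {T : Type} (F : set (set T)) : countable F ->
  exists G : nat -> set T,
  [/\ forall n, G n = set0 \/ F (G n), \bigcup_(Q in F) Q = \bigcup_n G n &
      trivIset F id -> trivIset setT G].
Proof.
move=> /countable_injP[h hinj].
exists (fun n => [set x | exists2 Q, F Q /\ h Q = n & Q x]); split.
- move=> n; have [[Q [FQ hQ]]|nQ] := pselect (exists Q, F Q /\ h Q = n).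
    right; set G := (X in F X); suff -> : G = Q by [].
    apply/seteqP; split => [x [Q' [FQ' hQ'] Q'x]|x Qx]; last by exists Q.
    by rewrite (hinj Q Q')// ?inE// hQ hQ'.
  left; apply/seteqP; split => // x [Q FhQ _]; apply: nQ; by exists Q.
- apply/seteqP; split; first by move=> x [Q FQ Qx]; exists (h Q) => //; exists Q.
  by move=> x [n _ [Q [FQ _] Qx]]; exists Q.
- move=> tF; apply/trivIsetP => i j _ _ ij; apply/seteqP; split => // x [].
  move=> [Q [FQ hQ] Qx] [Q' [FQ' hQ'] Q'x].
  have QQ' : Q = Q' by apply: tF => //; exists x.
  by move: ij; rewrite -hQ -hQ' QQ' eqxx.
Qed.

Lemma measurable_countable_bigcup {d} {T : measurableType d} (F : set (set T)) :
  countable F -> (forall Q, F Q -> measurable Q) ->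
  measurable (\bigcup_(Q in F) Q).
Proof.
move=> /countable_family_seq[G [GE -> _]] mF.
by apply: bigcup_measurable => n _; have [->|/mF] := GE n.
Qed.

(** Countable additivity on both sides reduces the bound to single members of [F]. Taking [setT] for
    [A] or [B] gives the measure of the union itself. *)
Lemma le_measure_bigcup {d} {T : measurableType d} {R : realType}
    (m1 m2 : {measure set T -> \bar R}) (F : set (set T)) (A B : set T) (c : R) :
  countable F -> trivIset F id -> (forall Q, F Q -> measurable Q) ->
  measurable A -> measurable B -> 0 <= c ->
  (forall Q, F Q -> (m1 (Q `&` A) <= c%:E * m2 (Q `&` B))%E) ->
  (m1 ((\bigcup_(Q in F) Q) `&` A) <= c%:E * m2 ((\bigcup_(Q in F) Q) `&` B))%E.
Proof.
move=> /countable_family_seq[G [GE -> tFG]] /tFG tG mF mA mB c0 le12.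
have mG n : measurable (G n) by have [->|/mF] := GE n.
have tGI (E : set T) : trivIset setT (fun n => G n `&` E).
  move/trivIsetP: tG => tG; apply/trivIsetP => i j _ _ ij.
  by rewrite setIACA tG// set0I.
rewrite !setI_bigcupl !measure_bigcup//; try by move=> n _; exact: measurableI.
rewrite -nneseriesZl//.
apply: lee_nneseries => // n _.
have [->|FG] := GE n; last exact: le12.
by rewrite !set0I !measure0 mule0.
Qed.

(** An infinite family would have more than [mu B / c] disjoint members, whose total mass exceeds
    that of [B]. *)
Lemma finite_trivIset_measure_ge {d} {T : measurableType d} {R : realType}
    (mu : {measure set T -> \bar R}) (F : set (set T)) (B : set T) (c : R) :
  measurable B -> (mu B < +oo)%E -> trivIset F id -> 0 < c ->
  (forall Q, F Q -> [/\ measurable Q, Q `<=` B & (c%:E <= mu Q)%E]) ->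
  finite_set F.
Proof.
move=> mB Boo tF c0 FP; apply: contrapT => infF.
have Bfin : mu B \is a fin_num by rewrite ge0_fin_numE.
pose N := Num.bound (fine (mu B) / c).
have ltN : fine (mu B) < c *+ N.
  rewrite -mulr_natl -ltr_pdivrMr//; apply: le_lt_trans (archi_boundP _) => //.
  by rewrite divr_ge0// ltW.
have /pcard_leP/unsquash f : ([set: nat] #<= F)%card by apply/infiniteP.
have fF k : F (f k) by apply: funS.
have finj : injective f by move=> i j; apply: inj; rewrite inE.
have mf k : measurable (f k) by have [] := FP _ (fF k).
have tf : trivIset setT f.
  by move=> i j _ _ fij; apply: finj; exact: (tF _ _ (fF i) (fF j) fij).
have : (mu (\big[setU/set0]_(i < N) f i) <= mu B)%E.
  apply: le_measure; rewrite ?inE//; first exact: bigsetU_measurable.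
  elim/big_ind: _ => //; first by move=> U V UB VB x [/UB|/VB].
  by move=> i _; have [] := FP _ (fF i).
rewrite measure_bigsetU// -(fineK Bfin) leNgt => /negP; apply.
apply: (@lt_le_trans _ _ (\sum_(i < N) c%:E)%E).
  by rewrite sumEFin lte_fin sumr_const card_ord.
by apply: lee_sum => i _; have [] := FP _ (fF i).
Qed.

(** * Spaces of homogeneous type *)

Section Homogeneous.
Context {R : realType} {d : measure_display} {T : measurableType d}.
Variables (K1 K2 : R) (rho : T -> T -> R) (mu : {measure set T -> \bar R}).
Hypothesis ht : homogeneous_type K1 K2 rho mu.

Lemma qball_subset (x : T) (r s : R) : r <= s ->
  qball rho x r%:E `<=` qball rho x s%:E.
Proof. by move=> rs y; rewrite /qball/= !lte_fin => /lt_le_trans; exact. Qed.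

Lemma qball_center (x : T) (r : R) : 0 < r -> qball rho x r%:E x.
Proof.
move=> r0; have [_ _ rho0 _] := ht_quasi_metric ht.
by rewrite /qball/= (rho0 x x).2.
Qed.

(** The constant is [Num.max K1 1] so that it is visibly positive, which keeps the last inequality
    strict. *)
Lemma qball_trans (x z : T) (r s : R) : qball rho z r%:E x ->
  qball rho x s%:E `<=` qball rho z (Num.max K1 1 * (r + s))%:E.
Proof.
have [rho_ge0 rhoC _ tri] := ht_quasi_metric ht.
rewrite /qball/= => zx y; rewrite /= !lte_fin in zx * => xy.
have h0 : 0 <= rho z x + rho x y by rewrite addr_ge0.
apply: (le_lt_trans (tri z y x)).
apply: (@le_lt_trans _ _ (Num.max K1 1 * (rho z x + rho x y))).
  by rewrite ler_wpM2r// le_max lexx.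
by rewrite ltr_pM2l ?ltrD// lt_max ltr01 orbT.
Qed.

Lemma measurable_qball (x : T) (r : R) : 0 < r -> measurable (qball rho x r%:E).
Proof. by move=> r0; apply: (ht_borel ht); exact: (ht_open_ball ht). Qed.

Lemma measure_qball_gt0 (x : T) (r : R) : 0 < r ->
  (0 < mu (qball rho x r%:E))%E.
Proof.
move=> r0; have r20 : 0 < r / 2 by rewrite divr_gt0.
by have [] := ht_doubling ht x r20; rewrite mulrC divfK.
Qed.

(** Doubling states finiteness of [K2 * mu B] only; the positive mass of the doubled ball forces
    [K2 > 0], so the factor can be removed. *)
Lemma measure_qball_lty (x : T) (r : R) : 0 < r ->
  (mu (qball rho x r%:E) < +oo)%E.
Proof.
move=> r0; have [m0 mle mlt] := ht_doubling ht x r0.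
move: mle mlt => m2.
have K2gt0 : 0 < K2.
  rewrite ltNge; apply/negP => K20; have := lt_le_trans m0 m2.
  by rewrite ltNge mule_le0_ge0.
case: (mu (qball rho x r%:E)) => [t _||//]; first by rewrite ltry.
by rewrite gt0_muley ?lte_fin.
Qed.

Lemma measure_qball_pow2 (m : nat) (x : T) (r : R) : 0 < r ->
  (mu (qball rho x (2 ^+ m * r)%:E) <=
     (Num.max K2 1 ^+ m)%:E * mu (qball rho x r%:E))%E.
Proof.
move=> r0; elim: m => [|m IH]; first by rewrite !expr0 mul1r mul1e.
have r20 : 0 < 2 ^+ m * r by rewrite mulr_gt0// exprn_gt0.
have [_ le2 _] := ht_doubling ht x r20.
rewrite exprS -mulrA; apply: (le_trans le2).
rewrite [in leRHS]exprS [in leRHS]EFinM -muleA.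
apply: (@le_trans _ _ ((Num.max K2 1)%:E * mu (qball rho x (2 ^+ m * r)%:E))%E).
  by rewrite lee_wpmul2r// lee_fin le_max lexx.
by rewrite lee_wpmul2l// lee_fin le_max ler01 orbT.
Qed.

Lemma measure_qball_scale (x z : T) (r s : R) (m : nat) : 0 < r ->
  qball rho x s%:E `<=` qball rho z (2 ^+ m * r)%:E -> 0 < s ->
  (mu (qball rho x s%:E) <= (Num.max K2 1 ^+ m)%:E * mu (qball rho z r%:E))%E.
Proof.
move=> r0 sub s0; apply: le_trans (measure_qball_pow2 m z r0).
by apply: le_measure => //; rewrite inE; apply: measurable_qball => //;
  rewrite mulr_gt0// exprn_gt0.
Qed.

(** A neighbourhood showing that [x] is outside the closure shows it for all of its own points, so
    the complement is open. *)
Lemma qclosure_measurable (A : set T) : measurable (qclosure rho A).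
Proof.
rewrite -[X in measurable X]setCK; apply: measurableC; apply: (ht_borel ht).
move=> x; rewrite /qclosure/= => /existsNP[U /not_implyP[oU /not_implyP[Ux UA]]].
have [r [r0 rU]] := oU _ Ux; exists r; split => // y /rU Uy.
by apply/existsNP; exists U => /(_ oU Uy).
Qed.

Lemma qball_exhaust (x : T) :
  mu (qball rho x n.+1%:R%:E) @[n --> \oo] --> mu setT.
Proof.
have -> : [set: T] = \bigcup_n qball rho x n.+1%:R%:E.
  apply/seteqP; split => // y _; exists (Num.bound (rho x y)) => //.
  rewrite /qball/= lte_fin; apply: lt_trans (_ : (Num.bound (rho x y))%:R < _).
    by apply: archi_boundP; have [] := ht_quasi_metric ht.
  by rewrite ltr_nat.
apply: nondecreasing_cvg_mu.
- by move=> n; exact: measurable_qball.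
- by apply: bigcup_measurable => n _; exact: measurable_qball.
- by move=> m n mn; apply/subsetPset; apply: qball_subset; rewrite ler_nat.
Qed.

Lemma qball_bounded (x : T) : (mu setT < +oo)%E ->
  exists r : R, 0 < r /\ qball rho x r%:E = setT.
Proof.
move=> Xoo; set K := Num.max K1 1; have K1_ge1 : 1 <= K by rewrite le_max lexx orbT.
have K_gt0 : 0 < K by exact: lt_le_trans ltr01 _.
have Xfin : mu setT \is a fin_num by rewrite ge0_fin_numE.
have X0 : 0 < fine (mu setT).
  rewrite fine_gt0// Xoo andbT; apply: lt_le_trans (measure_qball_gt0 x ltr01) _.
  by apply: le_measure => //; rewrite inE//; exact: measurable_qball.
(* The dilation [2 ^+ m] must carry the radius [t / (2 * K)] past [K * (2 * t + n.+1)], which is at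
   most [2 * K * t + t / 2] once [t >= 2 * K * n.+1]; as [K >= 1], [5 * K * K] is enough. *)
pose m := Num.bound (5 * K * K).
have m2 : 5 * K * K <= 2 ^+ m.
  apply/ltW/(lt_trans (archi_boundP _)); first by rewrite !mulr_ge0// ltW.
  by rewrite -natrX ltr_nat ltn_expl.
set M := Num.max K2 1 ^+ m.
have M1 : 1 <= M by rewrite exprn_ege1// le_max lexx orbT.
have M0 : 0 < M by exact: lt_le_trans ltr01 _.
(* Once a ball has more than [M/(M+1)] of the total mass, a far away ball
   comparable to its distance would by doubling have mass above [1/(M+1)]. *)
have [n ltn] : exists n, (((M / (M + 1)) * fine (mu setT))%:E < mu (qball rho x n.+1%:R%:E))%E.
  apply: contrapT => /forallNP nlt.
  have : (mu setT <= ((M / (M + 1)) * fine (mu setT))%:E)%E.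
    rewrite -[leLHS](cvg_lim _ (qball_exhaust x))//; apply: lime_le.
      by apply/cvg_ex; exists (mu setT); exact: qball_exhaust.
    by apply: nearW => k; rewrite leNgt; apply/negP; exact: nlt.
  rewrite -(fineK Xfin) lee_fin ler_pMl// leNgt => /negP; apply.
  by rewrite ltr_pdivrMr ?mul1r ?ltrDl// ltr_wpDl// ltW.
(* For [y] at distance [t >= 2 * K * n.+1], the ball of radius [t / (2 * K)] around [y] misses the
   large one: a common point would give [t < (2 * K * n.+1 + t) / 2 <= t]. *)
exists (2 * K * n.+1%:R); split; first by rewrite !mulr_gt0.
apply/seteqP; split => // y _; rewrite /qball/= lte_fin ltNge; apply/negP => ley.
set t := rho x y in ley.
have t0 : 0 < t by apply: lt_le_trans ley; rewrite !mulr_gt0.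
set B1 := qball rho x n.+1%:R%:E in ltn; set B2 := qball rho y (t / (2 * K))%:E.
have r20 : 0 < t / (2 * K) by rewrite divr_gt0// mulr_gt0.
have mB1 : measurable B1 by exact: measurable_qball.
have mB2 : measurable B2 by exact: measurable_qball.
have [_ rhoC _ _] := ht_quasi_metric ht.
have dis : B1 `&` B2 = set0.
  apply/seteqP; split => // z [B1z B2z].
  have zy : qball rho z (t / (2 * K))%:E y by move: B2z; rewrite /B2 /qball/= rhoC.
  have := qball_trans B1z zy; rewrite /qball/= -/t -/K lte_fin.
  have -> : K * (n.+1%:R + t / (2 * K)) = (2 * K * n.+1%:R + t) / 2.
    by field; rewrite gt_eqF.
  by rewrite ltr_pdivlMr//; move: ley; lra.
have le1M : (mu B1 <= M%:E * mu B2)%E.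
  apply: measure_qball_scale => //.
  have y2x : qball rho y (2 * t)%:E x by rewrite /qball/= lte_fin rhoC -/t; lra.
  apply: (subset_trans (qball_trans y2x)); apply: qball_subset; rewrite -/K.
  have -> : 2 ^+ m * (t / (2 * K)) = (2 ^+ m * t) / (2 * K) by rewrite mulrA.
  rewrite ler_pdivlMr ?mulr_gt0//.
  have h1 : 5 * K * K * t <= 2 ^+ m * t by rewrite ler_wpM2r// ltW.
  have h2 : t * K <= t * (K * K) by rewrite ler_pM2l// ler_peMl// ltW.
  have h3 : K * (2 * K * n.+1%:R) <= K * t by rewrite ler_pM2l.
  move: h1 h2 h3; rewrite -!mulrA; nra.
have b1 : mu B1 \is a fin_num by rewrite ge0_fin_numE// measure_qball_lty.
have b2 : mu B2 \is a fin_num by rewrite ge0_fin_numE// measure_qball_lty.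
have : (mu B1 + mu B2 <= mu setT)%E.
  rewrite -measureU//; apply: le_measure => //; rewrite inE//.
  exact: measurableU.
move: ltn le1M; rewrite -(fineK b1) -(fineK b2) -(fineK Xfin) -EFinD.
rewrite -EFinM !lte_fin !lee_fin mulrAC ltr_pdivrMr ?addr_gt0//.
nra.
Qed.

End Homogeneous.

(** * Dyadic cubes *)

(** The metric-free interface for the stopping-time argument. [dg_density] is what remains of
    Lebesgue differentiation; [dg_exhaust] and [dg_top] treat spaces of infinite and finite measure
    respectively. *)
Record dyadic_grid {R : realType} {d : measure_display} {T : measurableType d}
    (mu : {measure set T -> \bar R}) (D : R) (C : int -> set (set T)) : Prop :=
  DyadicGrid {
  dg_measurable : forall n Q, C n Q -> measurable Q ;
  dg_gt0 : forall n Q, C n Q -> (0 < mu Q)%E ;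
  dg_lty : forall n Q, C n Q -> (mu Q < +oo)%E ;
  dg_disjoint : forall n, trivIset (C n) id ;
  dg_parent : forall n Q, C n Q -> exists2 P, C (n - 1) P & Q `<=` P ;
  dg_doubling : forall n Q P, C n Q -> C (n - 1) P -> Q `<=` P ->
    (mu P <= D%:E * mu Q)%E ;
  dg_countable : forall n, countable (C n) ;
  dg_density : forall A, measurable A ->
    mu.-negligible (A `\` [set x | exists n Q,
      [/\ C n Q, Q x & (mu Q <= 2%:E * mu (Q `&` A))%E]]) ;
  dg_exhaust : mu setT = +oo%E -> forall n Q, C n Q -> forall M : R,
    exists n0 : int, forall m P, m <= n0 -> C m P -> Q `<=` P ->
      (M%:E <= mu P)%E ;
  dg_top : (mu setT < +oo)%E -> exists n, C n setT }.

Section DyadicCubes.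
Context {R : realType} {d : measure_display} {T : measurableType d}.
Variables (K1 K2 delta eps0 N0 : R) (rho : T -> T -> R).
Variables (mu : {measure set T -> \bar R}) (C : int -> set (set T)).
Hypotheses (ht : homogeneous_type K1 K2 rho mu).
Hypotheses (df : dyadic_filtration delta eps0 N0 rho mu C).
Hypotheses (delta01 : 0 < delta < 1) (eps0_gt0 : 0 < eps0).

Let delta0 : 0 < delta. Proof. by case/andP: delta01. Qed.
Let delta1 : delta < 1. Proof. by case/andP: delta01. Qed.
Let delta_unit : delta \is a GRing.unit. Proof. by rewrite unitfE gt_eqF. Qed.

(** [Num.bound] exceeds its argument only when that is nonnegative, and [N0] carries no sign, hence
    the maximum with [0]. *)
Definition cube_scale : nat := Num.bound (Num.max N0 0 / (eps0 * delta)).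

Definition cube_doubling : R := Num.max K2 1 ^+ cube_scale.

(* The exponent is chosen so that a dyadic cube of generation [n] or [n - 1]
   containing [z] lies in the ball of radius [cube_radius n] around [z]. *)
Definition cube_radius (n : int) : R := 2 ^+ cube_scale * (eps0 * delta ^ n).

Lemma cube_doubling_ge1 : 1 <= cube_doubling.
Proof. by rewrite exprn_ege1// le_max lexx orbT. Qed.

Let rad_gt0 n : 0 < eps0 * delta ^ n.
Proof. by rewrite mulr_gt0// exprz_gt0. Qed.

Lemma cube_radius_gt0 n : 0 < cube_radius n.
Proof. by rewrite mulr_gt0// exprn_gt0. Qed.

Let crad_gt0 := cube_radius_gt0.

Let delta_pred n : delta ^ n = delta * delta ^ (n - 1).
Proof. by rewrite -{2}(expr1z delta) -exprzDr// addrC subrK. Qed.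

Let diam_pred n : N0 * delta ^ (n - 1) < cube_radius n.
Proof.
rewrite /cube_radius (delta_pred n) !mulrA ltr_pM2r ?exprz_gt0// -mulrA.
rewrite -ltr_pdivrMr ?mulr_gt0//.
have := @archi_boundP _ (Num.max N0 0 / (eps0 * delta)).
rewrite -/cube_scale => /(_ _)/wrap[].
  by rewrite divr_ge0 ?le_max ?lexx ?orbT// ltW// mulr_gt0.
move=> h; apply: (@le_lt_trans _ _ (Num.max N0 0 / (eps0 * delta))).
  by rewrite ler_pM2r ?invr_gt0 ?mulr_gt0// le_max lexx.
by apply: (lt_trans h); rewrite -natrX ltr_nat ltn_expl.
Qed.

Let diam_self n : N0 * delta ^ n < cube_radius n.
Proof.
have [N0_ge0|N0_lt0] := leP 0 N0.
  apply: le_lt_trans (diam_pred n); rewrite ler_wpM2l//.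
  by rewrite (delta_pred n) ler_piMl ?ltW// exprz_gt0.
by apply: lt_trans (cube_radius_gt0 n); rewrite nmulr_rlt0// exprz_gt0.
Qed.

Let cube_diam n Q x y : C n Q -> Q x -> Q y -> rho x y <= N0 * delta ^ n.
Proof.
move=> CQ Qx Qy; rewrite -lee_fin; apply: le_trans (df_diam df CQ).
by apply: ereal_sup_ubound; exists (x, y).
Qed.

Let cube_measurable n Q : C n Q -> measurable Q.
Proof. by move=> CQ; apply: (ht_borel ht); exact: (df_open df CQ). Qed.

Lemma cube_sub_qball n Q x : C n Q -> Q x -> Q `<=` qball rho x (cube_radius n)%:E.
Proof.
move=> CQ Qx y Qy; rewrite /qball/= lte_fin.
exact: le_lt_trans (cube_diam CQ Qx Qy) (diam_self n).
Qed.

Lemma cube_qball n Q : C n Q -> exists2 z,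
  Q z & (mu (qball rho z (cube_radius n)%:E) <= cube_doubling%:E * mu Q)%E.
Proof.
move=> CQ; have [z zQ] := df_ball df CQ; exists z.
  exact/zQ/(qball_center ht).
apply: (le_trans (measure_qball_pow2 ht _ _ (rad_gt0 n))).
rewrite lee_wpmul2l ?lee_fin ?(le_trans ler01 cube_doubling_ge1)//.
apply: le_measure; rewrite ?inE//; last exact: cube_measurable CQ.
exact: (measurable_qball ht).
Qed.

Let cube_gt0 n Q : C n Q -> (0 < mu Q)%E.
Proof.
move=> CQ; have [z zQ] := df_ball df CQ.
apply: lt_le_trans (measure_qball_gt0 ht z (rad_gt0 n)) _.
apply: le_measure; rewrite ?inE//; last exact: cube_measurable CQ.
exact: (measurable_qball ht).
Qed.

Let cube_lty n Q : C n Q -> (mu Q < +oo)%E.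
Proof.
move=> CQ; have [z Qz _] := cube_qball CQ.
apply: le_lt_trans (measure_qball_lty ht z (cube_radius_gt0 n)).
apply: le_measure; rewrite ?inE//; first exact: cube_measurable CQ.
  exact: (measurable_qball ht).
exact: cube_sub_qball CQ Qz.
Qed.

Let cube_parent_doubling n Q P : C n Q -> C (n - 1) P -> Q `<=` P ->
  (mu P <= cube_doubling%:E * mu Q)%E.
Proof.
move=> CQ CP QP; have [z Qz zle] := cube_qball CQ.
apply: le_trans zle; apply: le_measure; rewrite ?inE//.
- exact: cube_measurable CP.
- exact: (measurable_qball ht).
- move=> y Py; rewrite /qball/= lte_fin.
  exact: le_lt_trans (cube_diam CP (QP _ Qz) Py) (diam_pred n).
Qed.

(** Extends [cube_qball] from the centre to every point of the cube, since the ball around [x] lies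
    in a dilated ball around the centre. The constant [M] enters only the qualitative facts on
    countability, density and exhaustion, never the doubling constant [D]. *)
Lemma cube_centered_doubling : exists2 M : R, 1 <= M &
  forall n Q x, C n Q -> Q x ->
    (mu (qball rho x (cube_radius n)%:E) <= M%:E * mu Q)%E.
Proof.
pose K := Num.max K1 1; pose m := Num.bound (2 * K).
have K_gt0 : 0 < K by rewrite lt_max ltr01 orbT.
exists (Num.max K2 1 ^+ (m + cube_scale)).
  by rewrite exprn_ege1// le_max lexx orbT.
move=> n Q x CQ Qx; have [z zQ] := df_ball df CQ.
have Qz : Q z by exact/zQ/(qball_center ht).
have zx : qball rho z (cube_radius n)%:E x by exact: cube_sub_qball CQ Qz _ Qx.
apply: (@le_trans _ _ ((Num.max K2 1 ^+ (m + cube_scale))%:E *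
                       mu (qball rho z (eps0 * delta ^ n)%:E))%E).
  apply: (measure_qball_scale ht) => //.
  apply: (subset_trans (qball_trans ht zx)); apply: qball_subset.
  have -> : Num.max K1 1 * (cube_radius n + cube_radius n) = 2 * K * cube_radius n.
    by rewrite /K; ring.
  have -> : 2 ^+ (m + cube_scale) * (eps0 * delta ^ n) = 2 ^+ m * cube_radius n.
    by rewrite exprD -mulrA.
  rewrite ler_pM2r//; apply/ltW/(lt_trans (archi_boundP _)).
    by rewrite mulr_ge0// ltW.
  by rewrite -natrX ltr_nat ltn_expl.
rewrite lee_wpmul2l ?lee_fin ?exprn_ge0// ?le_max ?ler01 ?orbT//.
apply: le_measure; rewrite ?inE//; last exact: cube_measurable CQ.
exact: (measurable_qball ht).
Qed.

Let cube_radius_small (e : R) : 0 < e ->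
  exists k : nat, cube_radius (Posz k) < e.
Proof.
move=> e0; set s := 2 ^+ cube_scale * eps0.
have s0 : 0 < s by rewrite mulr_gt0// exprn_gt0.
have /cvgr0_norm_lt/(_ (e / s)) : delta ^+ n @[n --> \oo] --> (0 : R).
  by apply: cvg_expr; rewrite gtr0_norm.
rewrite divr_gt0// => /(_ isT)[k _ /(_ k (leqnn k))/=].
rewrite gtr0_norm ?exprn_gt0// => dk; exists k.
by rewrite /cube_radius mulrA mulrC -ltr_pdivlMr.
Qed.

Let cube_radius_large (e : R) : exists n, forall m, m <= n -> e < cube_radius m.
Proof.
set s := 2 ^+ cube_scale * eps0.
have s0 : 0 < s by rewrite mulr_gt0// exprn_gt0.
have /cvgr0_norm_lt/(_ (s / (`|e| + 1))) : delta ^+ n @[n --> \oo] --> (0 : R).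
  by apply: cvg_expr; rewrite gtr0_norm.
rewrite divr_gt0// ?ltr_wpDl// => /(_ isT)[k _ /(_ k (leqnn k))/=].
rewrite gtr0_norm ?exprn_gt0// => dk; exists (- Posz k) => m mk.
rewrite /cube_radius mulrA -/s.
have dm : (delta ^+ k)^-1 <= delta ^ m.
  rewrite -[m]opprK -exprVn -exprz_inv; apply: (@ler_weXz2l _ _ _ (Posz k)).
    by rewrite invf_ge1// ltW.
  by rewrite lerNr.
apply: (@lt_le_trans _ _ (s * (delta ^+ k)^-1)); last by rewrite ler_pM2l.
rewrite ltr_pdivlMr ?exprn_gt0//.
rewrite ltr_pdivlMr ?ltr_wpDl// in dk.
apply: le_lt_trans dk; rewrite mulrC ler_pM2l ?exprn_gt0//.
by apply: (le_trans (ler_norm _)); rewrite lerDl.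
Qed.

(** Each ball meets finitely many cubes of one generation: they are disjoint, lie in one larger
    ball, and have measure bounded below. *)
Let cube_countable n : countable (C n).
Proof.
have [M M1 CM] := cube_centered_doubling.
pose B k := qball rho point k.+1%:R%:E.
have -> : C n = \bigcup_k [set Q | C n Q /\ Q `&` B k !=set0].
  apply/seteqP; split => [Q CQ|Q [k _ []//]].
  have [x Qx _] := cube_qball CQ.
  exists (Num.bound (rho point x)) => //; split => //; exists x; split => //.
  rewrite /B/qball/= lte_fin; apply: lt_trans (_ : (Num.bound (rho point x))%:R < _).
    by apply: archi_boundP; have [] := ht_quasi_metric ht.
  by rewrite ltr_nat.
apply: bigcup_countable => // k _; apply: finite_set_countable.
set K := Num.max K1 1; have K_gt0 : 0 < K by rewrite lt_max ltr01 orbT.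
pose r := K * (k.+1%:R + cube_radius n).
have r0 : 0 < r by rewrite mulr_gt0// addr_gt0.
pose m := Num.bound (K * (r + r) / cube_radius n).
(* All these cubes lie in a fixed ball, which in turn lies in a fixed dilation
   of the ball around the centre of each of them. *)
have big x : qball rho point r%:E x ->
    (mu (qball rho point r%:E) <=
     (Num.max K2 1 ^+ m)%:E * mu (qball rho x (cube_radius n)%:E))%E.
  move=> px; apply: (measure_qball_scale ht) => //.
  have xp : qball rho x r%:E point.
    by have [_ rhoC _ _] := ht_quasi_metric ht; move: px; rewrite /qball/= rhoC.
  apply: (subset_trans (qball_trans ht xp)); apply: qball_subset.
  rewrite -ler_pdivrMr//; apply/ltW/(lt_trans (archi_boundP _)).
    by rewrite ltW// divr_gt0// mulr_gt0// addr_gt0.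
  by rewrite -natrX ltr_nat ltn_expl.
set N := Num.max K2 1 ^+ m in big.
have N0' : 0 < N by rewrite exprn_gt0// lt_max ltr01 orbT.
have M0 : 0 < M by exact: lt_le_trans ltr01 _.
have bfin : mu (qball rho point r%:E) \is a fin_num.
  by rewrite ge0_fin_numE// (measure_qball_lty ht).
apply: (@finite_trivIset_measure_ge _ _ _ mu _ (qball rho point r%:E)
   (fine (mu (qball rho point r%:E)) / (N * M))).
- exact: (measurable_qball ht).
- exact: (measure_qball_lty ht).
- by move=> Q Q' [CQ _] [CQ' _]; exact: (df_disjoint df CQ CQ').
- rewrite divr_gt0 ?mulr_gt0// fine_gt0// (measure_qball_gt0 ht)//.
  by rewrite (measure_qball_lty ht).
- move=> Q [CQ [x [Qx Bx]]]; split; first exact: cube_measurable CQ.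
    apply: (subset_trans (cube_sub_qball CQ Qx)).
    exact: (qball_trans ht Bx).
  have Qfin : mu Q \is a fin_num by rewrite ge0_fin_numE// (cube_lty CQ).
  have px : qball rho point r%:E x.
    by apply: (qball_trans ht Bx); exact: (qball_center ht).
  have := le_trans (big _ px) (lee_wpmul2l _ (CM _ _ _ CQ Qx)).
  rewrite lee_fin => /(_ (ltW N0')).
  rewrite -(fineK bfin) -(fineK Qfin) -!EFinM !lee_fin.
  by rewrite ler_pdivrMr ?mulr_gt0// [_ * (N * M)]mulrC mulrA.
Qed.

(** Differentiating the indicator of [A] makes the part of a small ball outside [A] less than
    [1 / (2 * M)] of the ball. The cube of that scale around [x] fills at least [1 / M] of the ball,
    so at most half of the cube is lost. *)
Let cube_density A : measurable A ->
  mu.-negligible (A `\` [set x | exists n Q,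
    [/\ C n Q, Q x & (mu Q <= 2%:E * mu (Q `&` A))%E]]).
Proof.
move=> mA; have [M M1 CM] := cube_centered_doubling.
have M0 : 0 < M by exact: lt_le_trans ltr01 _.
have intA x (r : R) : 0 < r ->
    mu.-integrable (qball rho x r%:E) (EFin \o (\1_A : T -> R)).
  move=> r0; have mB := measurable_qball ht x r0.
  apply/integrableP; split; first by apply/measurable_EFinP; exact: measurable_indic.
  under eq_integral do rewrite /= ger0_norm//.
  rewrite integral_indic//; apply: le_lt_trans (measure_qball_lty ht x r0).
  by apply: le_measure; rewrite ?inE//; exact: measurableI.
have lebA := ht_lebesgue ht (measurable_indic mA) intA.
(* Points missed by some generation join the exceptional set, so that a cube of every small scale is
   available at the others. *)
have : mu.-negligible (\bigcup_k ~` \bigcup_(Q in C (Posz k)) Q).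
  apply: negligible_bigcup => k; apply/negligibleP; last exact: (df_cover df).
  apply: measurableC; apply: (ht_borel ht) => x [Q CQ Qx].
  have [r [r0 rQ]] := df_open df CQ Qx; exists r; split => // y /rQ Qy.
  by exists Q.
move=> /(negligibleU lebA); apply: negligibleS => x [Ax ndx].
have [xC|xC] := pselect (forall k, (\bigcup_(Q in C (Posz k)) Q) x); last first.
  by right; move/existsNP : xC => [k kx]; exists k.
left => /= avgx; apply: ndx.
have iM0 : 0 < (2 * M)^-1 by rewrite invr_gt0 mulr_gt0.
have /cvgrPdist_lt/(_ _ iM0)[e /= e0 eavg] := avgx.
have [k ke] := cube_radius_small e0.
have r0 := cube_radius_gt0 (Posz k); set r := cube_radius k in ke r0.
have {eavg} : 1 - (2 * M)^-1 < average mu (qball rho x r%:E) \1_A.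
  have := eavg r; rewrite /= sub0r normrN gtr0_norm// => /(_ ke r0).
  by rewrite indicE mem_set//= ltr_norml => /andP[_]; rewrite ltrBlDl -ltrBlDr.
have [Q CQ Qx] := xC k; rewrite /average /Rintegral => avgr.
exists (Posz k), Q; split => //.
have mB := measurable_qball ht x r0; have mQ := cube_measurable CQ.
have QB : Q `<=` qball rho x r%:E by exact: cube_sub_qball CQ Qx.
have BQ := CM _ _ _ CQ Qx; rewrite -/r in BQ.
have B0 := measure_qball_gt0 ht x r0; have Boo := measure_qball_lty ht x r0.
set B := qball rho x r%:E in mB QB BQ B0 Boo avgr.
rewrite integral_indic// in avgr.
have Bfin : mu B \is a fin_num by rewrite ge0_fin_numE.
have Qfin : mu Q \is a fin_num by rewrite ge0_fin_numE// (cube_lty CQ).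
have subfin E F : measurable E -> measurable F -> mu F \is a fin_num ->
    E `<=` F -> mu E \is a fin_num.
  move=> mE mF Ffin EF; rewrite ge0_fin_numE//.
  by rewrite (le_lt_trans (le_measure mu _ _ EF)) ?inE// -ge0_fin_numE.
have mAB : measurable (A `&` B) by exact: measurableI.
have mBA : measurable (B `\` A) by exact: measurableD.
have mQA : measurable (Q `&` A) by exact: measurableI.
have mQDA : measurable (Q `\` A) by exact: measurableD.
have ABfin := subfin _ _ mAB mB Bfin (@subIsetr _ _ _).
have BAfin := subfin _ _ mBA mB Bfin (@subDsetl _ _ _).
have QAfin := subfin _ _ mQA mQ Qfin (@subIsetl _ _ _).
have QDAfin := subfin _ _ mQDA mQ Qfin (@subDsetl _ _ _).
have splitB : mu B = (mu (A `&` B) + mu (B `\` A))%E.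
  by rewrite setIC addeC -measureDI.
have splitQ : mu Q = (mu (Q `&` A) + mu (Q `\` A))%E.
  by rewrite addeC -measureDI.
have leD : (mu (Q `\` A) <= mu (B `\` A))%E.
  by apply: le_measure; rewrite ?inE//; exact: setSD.
have fB0 : 0 < fine (mu B) by rewrite fine_gt0// B0.
rewrite ltr_pdivlMl// in avgr.
move: splitB splitQ leD BQ avgr fB0.
rewrite -(fineK Bfin) -(fineK Qfin) -(fineK ABfin) -(fineK BAfin).
rewrite -(fineK QAfin) -(fineK QDAfin) -!EFinD -!EFinM !lee_fin /=.
move=> [bE] [qE] leD BQ avgr fB0.
have : (2 * M)^-1 * fine (mu B) <= 2^-1 * fine (mu Q).
  by rewrite invfM -mulrA ler_pM2l// mulrC ler_pdivrMr// mulrC.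
move: avgr; rewrite mulrBr mulr1 [_ * (2 * M)^-1]mulrC; lra.
Qed.

(** An ancestor of [Q] has mass at least [1 / M] of a ball around a fixed point of [Q], and these
    balls exhaust the space. *)
Let cube_exhaust : mu setT = +oo%E -> forall n Q, C n Q -> forall M : R,
  exists n0 : int, forall m P, m <= n0 -> C m P -> Q `<=` P ->
    (M%:E <= mu P)%E.
Proof.
move=> Xoo n Q CQ L; have [x Qx _] := cube_qball CQ.
have [M M1 CM] := cube_centered_doubling.
have M0 : 0 < M by exact: lt_le_trans ltr01 _.
have := qball_exhaust ht x; rewrite Xoo => /cvgeyPge/(_ (M * L)).
move=> [k _ /(_ k (leqnn k))/= Lk].
have [n0 n0k] := cube_radius_large k.+1%:R; exists n0 => m P mn CP QP.
have := CM _ _ _ CP (QP _ Qx); move/(le_trans _) => /(_ (M * L)%:E).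
rewrite EFinM lee_pmul2l//; apply; apply: (le_trans Lk).
apply: le_measure; rewrite ?inE//; try exact: (measurable_qball ht).
by apply: qball_subset; exact/ltW/n0k.
Qed.

Let cube_top : (mu setT < +oo)%E -> exists n, C n setT.
Proof.
move=> Xoo; have [r [r0 rX]] := qball_bounded ht point Xoo.
set K := Num.max K1 1.
(* After cancelling [2 ^+ cube_scale], the inner ball of a cube of generation [n] has radius above
   [K * (r + r)], so it contains the whole bounded space. *)
have [n n_r] := cube_radius_large (2 ^+ cube_scale * (K * (r + r))).
exists n; have [Q CQ] : exists Q, C n Q.
  apply: contrapT => /forallNP nC.
  have := df_cover df n; rewrite bigcup0; last by move=> Q /nC.
  rewrite setC0 => X0; have := measure_qball_gt0 ht point ltr01.
  rewrite ltNge -X0 le_measure ?inE//; exact: (measurable_qball ht).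
suff <- : Q = setT by [].
apply/seteqP; split => // y _; have [z zQ] := df_ball df CQ; apply: zQ.
have zp : qball rho z r%:E point.
  have [_ rhoC _ _] := ht_quasi_metric ht.
  have : [set: T] z by []; rewrite -rX /qball/= => h; by rewrite rhoC.
have yp : qball rho point r%:E y by rewrite rX.
have := qball_trans ht zp yp; apply: qball_subset.
have := n_r n (lexx n); rewrite /cube_radius ltr_pM2l ?exprn_gt0//.
exact: ltW.
Qed.

Lemma dyadic_filtration_grid : dyadic_grid mu cube_doubling C.
Proof.
split.
- exact: cube_measurable.
- exact: cube_gt0.
- exact: cube_lty.
- exact: (df_disjoint df).
- by move=> n Q /(df_parent df)[P [[CP QP] _]]; exists P.
- exact: cube_parent_doubling.
- exact: cube_countable.
- exact: cube_density.
- exact: cube_exhaust.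
- exact: cube_top.
Qed.

End DyadicCubes.

(** * The A_q condition *)

Lemma integral_gt0 {d} {T : measurableType d} {R : realType}
    (mu : {measure set T -> \bar R}) (D : set T) (f : T -> \bar R) :
  measurable D -> (0 < mu D)%E -> measurable_fun D f ->
  (forall x, (0 <= f x)%E) -> {ae mu, forall x, (0 < f x)%E} ->
  (0 < \int[mu]_(x in D) f x)%E.
Proof.
move=> mD D0 mf f0 fgt0; rewrite lt_neqAle eq_sym integral_ge0 ?andbT//.
apply/eqP => intf0.
have : (\int[mu]_(x in D) `|f x| = 0)%E.
  by rewrite -[RHS]intf0; apply: eq_integral => x _; rewrite gee0_abs.
move=> /(ae_eq_integral_abs _ mD mf).1 fD0.
move: D0; rewrite lt_neqAle => /andP[/eqP muD _]; apply: muD; apply/esym.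
apply: measure_negligible => //.
have := negligibleU fgt0 fD0; apply: negligibleS => x Dx /=.
have [fx|fx] := pselect (0 < f x)%E; last by left.
by right => /(_ Dx) fx0; move: fx; rewrite fx0 ltxx.
Qed.

Section ApWeight.
Context {R : realType} {d : measure_display} {T : measurableType d}.
Variables (K1 K2 q K0 : R) (rho : T -> T -> R) (mu : {measure set T -> \bar R}).
Variable w : T -> R.
Hypotheses (ht : homogeneous_type K1 K2 rho mu) (hq : 1 < q).
Hypotheses (wA : Ap_weight rho mu q w) (wK : (Ap_const rho mu q w <= K0%:E)%E).

Let mw : measurable_fun setT w. Proof. by case: wA. Qed.
Let w0 x : 0 <= w x. Proof. by case: wA. Qed.
Let q1 : 0 < q - 1. Proof. by rewrite subr_gt0. Qed.

Let mwD D : measurable D -> measurable_fun D (EFin \o w).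
Proof. by move=> mD; apply/measurable_EFinP; exact: measurable_funTS. Qed.

(** The dual weight of the [A_q] condition, equal to [+oo] where [w] vanishes. *)
Let sigma (x : T) : \bar R := ((w x)%:E^-1 `^ (q - 1)^-1)%E.

Let msigma D : measurable D -> measurable_fun D sigma.
Proof.
move=> mD; apply: measurable_funTS; rewrite /sigma.
apply: (measurableT_comp (measurable_poweR _)).
under eq_fun do rewrite inver.
apply: measurable_fun_ifT => //.
  exact: measurable_fun_eqr.
apply/measurable_EFinP; under eq_fun do rewrite -powR_inv1//.
exact: (measurableT_comp (measurable_powR _)).
Qed.

Let sigma_gt0 x : (0 < sigma x)%E.
Proof.
rewrite /sigma inver; case: ifPn => wx; first by rewrite poweRyr ?invr_eq0 ?gt_eqF.
by rewrite poweR_gt0// lte_fin invr_gt0 lt_neqAle eq_sym wx w0.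
Qed.

Lemma Ap_weight_gt0 (E : set T) : measurable E -> (0 < mu E)%E ->
  (0 < \int[mu]_(x in E) (w x)%:E)%E.
Proof.
move=> mE E0; apply: integral_gt0 => //; first exact: mwD.
by case: wA => _ _ wgt0 _; apply: filterS wgt0 => x; rewrite lte_fin.
Qed.

(* Integrated and optimized in [t], this replaces Hölder's inequality below. *)
Lemma le_powR_add (t x : R) : 0 < t -> 0 <= x ->
  (1 <= (t `^ (q - 1) * x)%:E + t^-1%:E * (x%:E^-1 `^ (q - 1)^-1))%E.
Proof.
move=> t0 x0; rewrite inver; have [->|xN0] := eqVneq x 0.
  by rewrite mulr0 poweRyr ?invr_eq0 ?gt_eqF// gt0_muley ?lte_fin ?invr_gt0// add0e leey.
have {x0 xN0} x0 : 0 < x by rewrite lt_neqAle eq_sym xN0 x0.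
rewrite poweR_EFin -EFinM -EFinD lee_fin.
have tq0 : 0 < t `^ (q - 1) by rewrite powR_gt0.
(* Either the first summand is at least [1], or [x^-1] exceeds [t ^ (q - 1)] and the second one
   is. *)
have [tx|tx] := leP 1 (t `^ (q - 1) * x).
  by rewrite (le_trans tx)// lerDl mulr_ge0// ?invr_ge0 ?powR_ge0// ltW.
apply: ler_wpDl; first by rewrite mulr_ge0 ?powR_ge0// ltW.
rewrite -(@ler_pM2l _ t)// mulr1 mulrA divff ?gt_eqF// mul1r.
have {1}-> : t = (t `^ (q - 1)) `^ (q - 1)^-1.
  by rewrite -powRrM divff ?gt_eqF// powRr1// ltW.
apply: ge0_ler_powR; rewrite ?nnegrE ?invr_ge0 ?ltW//.
by rewrite -[ltRHS]mul1r ltr_pdivlMr.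
Qed.

(** Both factors of the [A_q] product are positive, so an infinite integral would make the product
    infinite. All quantities are therefore real, as the arithmetic of [Ap_lower] requires. *)
Let Ap_qball (x0 : T) (r : R) : 0 < r -> exists b W S : R,
  [/\ 0 < b /\ mu (qball rho x0 r%:E) = b%:E,
      0 < W /\ (\int[mu]_(x in qball rho x0 r%:E) (w x)%:E)%E = W%:E,
      0 < S /\ (\int[mu]_(x in qball rho x0 r%:E) sigma x)%E = S%:E &
      W / b * (S / b) `^ (q - 1) <= K0].
Proof.
move=> r0; set B := qball rho x0 r%:E.
have mB : measurable B by exact: (measurable_qball ht).
have B0 : (0 < mu B)%E by exact: (measure_qball_gt0 ht).
have Boo : (mu B < +oo)%E by exact: (measure_qball_lty ht).
have W0 := Ap_weight_gt0 mB B0.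
have S0 : (0 < \int[mu]_(x in B) sigma x)%E.
  by apply: integral_gt0 => //; [exact: msigma|move=> x; exact: ltW|exact: aeW].
have : (((mu B)^-1 * \int[mu]_(x in B) (w x)%:E) *
        ((mu B)^-1 * \int[mu]_(x in B) sigma x) `^ (q - 1) <= K0%:E)%E.
  by apply: le_trans wK; apply: ereal_sup_ubound; exists (x0, r).
move: B0 Boo W0 S0; case: (mu B) => [b||]//; rewrite lte_fin => b0 _.
rewrite inver gt_eqF//; have ib0 : 0 < b^-1 by rewrite invr_gt0.
case: (integral mu B _) => [W||]//; case: (integral mu B _) => [S||]//;
  rewrite ?lte_fin => W0 S0.
- rewrite -(EFinM b^-1 S) -(EFinM b^-1 W) poweR_EFin -EFinM lee_fin => WS.
  exists b, W, S; split => //.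
  by rewrite [W / b]mulrC [S / b]mulrC.
- rewrite gt0_muley ?lte_fin// poweRyr ?gt_eqF// gt0_muley ?leye_eq//.
  by rewrite -EFinM lte_fin mulr_gt0.
- rewrite gt0_muley ?lte_fin// gt0_mulye ?leye_eq//.
  by rewrite poweR_gt0// -EFinM lte_fin mulr_gt0.
- rewrite gt0_muley ?lte_fin// poweRyr ?gt_eqF// gt0_muley ?leye_eq//.
Qed.

Lemma Ap_qball_lty (x0 : T) (r : R) : 0 < r ->
  (\int[mu]_(x in qball rho x0 r%:E) (w x)%:E < +oo)%E.
Proof. by move=> /(Ap_qball x0)[b [W [S [_ [_ ->]]]]]; rewrite ltry. Qed.

(** Integrating [le_powR_add] over [E] bounds [mu E] by [t ^ (q - 1)] times the weight of [E] plus
    [t^-1] times the dual weight of [B]. The second term is absorbed by the choice of [t], and the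
    [A_q] bound removes the dual weight. *)
Lemma Ap_lower (x0 : T) (r theta : R) (E : set T) : 0 < r -> 0 < theta ->
  let B := qball rho x0 r%:E in
  measurable E -> E `<=` B -> (theta%:E * mu B <= mu E)%E ->
  (\int[mu]_(x in B) (w x)%:E <=
     ((2 / theta) `^ q * K0)%:E * \int[mu]_(x in E) (w x)%:E)%E.
Proof.
move=> r0 th0 B mE EB thE.
have mB : measurable B by exact: (measurable_qball ht).
have [b [W [S [[b0 bE] [W0 WE] [S0 SE] WS]]]] := Ap_qball x0 r0.
have key t : 0 < t ->
   (mu E <= (t `^ (q - 1))%:E * (\int[mu]_(x in E) (w x)%:E) + t^-1%:E * S%:E)%E.
  move=> t0; rewrite -[leLHS]mul1e -(integral_cst mu mE) -SE.
  apply: (@le_trans _ _ (\int[mu]_(x in E)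
      ((t `^ (q - 1))%:E * (w x)%:E + t^-1%:E * sigma x))%E).
    apply: ge0_le_integral => //.
    - by apply: emeasurable_funD; apply: emeasurable_funM => //;
        [exact: mwD|exact: msigma].
    - by move=> x _; rewrite -EFinM; exact: le_powR_add.
  rewrite ge0_integralD//; first last.
  - by apply: emeasurable_funM => //; exact: msigma.
  - by move=> x _; rewrite mule_ge0 ?lee_fin ?invr_ge0 ?ltW.
  - by apply: emeasurable_funM => //; exact: mwD.
  - by move=> x _; rewrite mule_ge0 ?lee_fin ?powR_ge0.
  rewrite !ge0_integralZl_EFin//; try by [exact: mwD|exact: msigma|
    exact: powR_ge0|rewrite invr_ge0 ltW|move=> x _; rewrite lee_fin|
    move=> x _; exact: ltW].
  apply: leeD2l; apply: lee_wpmul2l; first by rewrite lee_fin invr_ge0 ltW.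
  by apply: ge0_subset_integral => //; [exact: msigma|move=> x _; exact: ltW].
have oE0 : (0 <= \int[mu]_(x in E) (w x)%:E)%E.
  by apply: integral_ge0 => x _; rewrite lee_fin.
have oEoo : (\int[mu]_(x in E) (w x)%:E < +oo)%E.
  apply: le_lt_trans (Ap_qball_lty x0 r0).
  by apply: ge0_subset_integral => //; [exact: mwD|move=> x _; rewrite lee_fin].
rewrite WE; case: (integral mu E _) oE0 oEoo key => [e||]// e0 _ key.
(* This [t] makes the dual term equal to [theta * b / 2], half of the lower bound for [mu E]. *)
have t0 : 0 < 2 * S / (theta * b) by rewrite divr_gt0 ?mulr_gt0.
have := le_trans thE (key _ t0); rewrite bE -!EFinM -EFinD !lee_fin in e0 *.
have -> : (2 * S / (theta * b))^-1 * S = theta * b / 2.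
  by field; rewrite !gt_eqF.
have -> : 2 * S / (theta * b) = (2 / theta) * (S / b).
  by field; rewrite !gt_eqF.
have d1 : 0 <= 2 / theta by rewrite ltW// divr_gt0.
have d2 : 0 <= S / b by rewrite ltW// divr_gt0.
rewrite (@powRM _ (2 / theta) (S / b))//; set X := (_ / theta) `^ (q - 1).
set Y := (S / b) `^ _ in WS *.
have X0 : 0 < X by rewrite powR_gt0// divr_gt0.
have -> : (2 / theta) `^ q = 2 / theta * X.
  by rewrite /X mulr_powRB1// ?divr_ge0 ?ltW// (lt_trans ltr01).
move=> h.
have h1 : theta * b / 2 <= X * Y * e by move: h; lra.
have h2 : W * Y <= K0 * b by rewrite mulrAC ler_pdivrMr// in WS.
have h3 : W * (theta * b / 2) <= X * e * (K0 * b).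
  apply: (@le_trans _ _ (W * (X * Y * e))); first by rewrite ler_pM2l.
  have -> : W * (X * Y * e) = X * e * (W * Y) by ring.
  by rewrite ler_wpM2l// mulr_ge0// ltW.
have -> : 2 / theta * X * K0 * e = (X * e * (K0 * b)) / (theta * b / 2).
  by field; rewrite !gt_eqF.
by rewrite ler_pdivlMr// divr_gt0// mulr_gt0.
Qed.

End ApWeight.

(** * Maximal dense cubes and the good-lambda inequality *)

(** Chebyshev's inequality, used for oscillations and for the [L_1] bound on [v]. *)
Lemma mul_measure_le_integral {d} {T : measurableType d} {R : realType}
    (mu : {measure set T -> \bar R}) (E Q : set T) (h : T -> R) (a : R) :
  measurable E -> measurable Q -> E `<=` Q -> measurable_fun Q h ->
  (forall x, 0 <= h x) -> 0 <= a -> (forall x, E x -> a <= h x) ->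
  (a%:E * mu E <= \int[mu]_(x in Q) (h x)%:E)%E.
Proof.
move=> mE mQ EQ mh h0 a0 ah; rewrite -(integral_cst mu mE).
apply: (@le_trans _ _ (\int[mu]_(x in E) (h x)%:E)%E).
  apply: ge0_le_integral => //.
  exact/measurable_EFinP/(measurable_funS mQ EQ mh).
apply: ge0_subset_integral => //; first exact/measurable_EFinP; by move=> x _; rewrite lee_fin.
Qed.

(** A number [a] cannot be close to [h] both on [E], where [h > l], and on at least half of [Q],
    where [h <= l / 4]. The bound thus holds for every [a], in particular for the average. *)
Lemma oscillation_lower {d} {T : measurableType d} {R : realType}
    (mu : {measure set T -> \bar R}) (Q A E : set T) (h : T -> R) (a l : R) :
  measurable Q -> (0 < mu Q)%E -> (mu Q < +oo)%E -> measurable A ->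
  measurable E -> E `<=` Q ->
  (2%:E * mu (Q `&` A) <= mu Q)%E -> mu.-integrable Q (EFin \o h) -> 0 < l ->
  (forall x, (Q `\` A) x -> h x <= l / 4) -> (forall x, E x -> l < h x) ->
  l / 8 * fine (mu E) <= fine (mu Q) * average mu Q (fun x => `|h x - a|).
Proof.
move=> mQ Q0 Qoo mA mE EQ A2 ih l0 hA hE.
have Qfin : mu Q \is a fin_num by rewrite ge0_fin_numE.
have subfin F : measurable F -> F `<=` Q -> mu F \is a fin_num.
  move=> mF FQ; rewrite ge0_fin_numE//.
  by rewrite (le_lt_trans (le_measure mu _ _ FQ)) ?inE.
have fQ0 : 0 < fine (mu Q) by rewrite fine_gt0// Q0.
rewrite /average mulrA divff ?gt_eqF// mul1r /Rintegral.
have mh : measurable_fun Q h by apply/measurable_EFinP; exact: measurable_int ih.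
have mha : measurable_fun Q (fun x => `|h x - a|).
  by apply: measurableT_comp => //; exact: measurable_funB.
have ia : mu.-integrable Q (EFin \o cst a).
  apply/integrableP; split; first exact/measurable_EFinP.
  under eq_integral do rewrite /=.
  by rewrite integral_cst// muleC lte_mul_pinfty// -ge0_fin_numE.
have iha : mu.-integrable Q (EFin \o (fun x => `|h x - a|)).
  apply: eq_integrable (integrable_abse (integrableB mQ ih ia)) => //.
have Ifin := integrable_fin_num mQ iha.
have lower F b : measurable F -> F `<=` Q -> 0 <= b ->
    (forall x, F x -> b <= `|h x - a|) ->
    b * fine (mu F) <= fine (\int[mu]_(x in Q) `|h x - a|%:E).
  move=> mF FQ b0 bF; rewrite -lee_fin fineK// EFinM (fineK (subfin F mF FQ)).
  exact: mul_measure_le_integral.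
have EleQ : fine (mu E) <= fine (mu Q).
  by apply: fine_le => //; [exact: subfin|apply: le_measure; rewrite ?inE].
have fE0 := fine_ge0 (measure_ge0 mu E).
(* Either [h - a >= l / 2] on [E], or [a - h >= l / 4] on half of [Q]. *)
have [al|al] := leP a (l / 2).
  apply: (@le_trans _ _ (l / 2 * fine (mu E))); first by rewrite ler_wpM2r//; lra.
  apply: lower => //; first by lra.
  move=> x /hE lh; rewrite ger0_norm; lra.
have mQA : measurable (Q `\` A) by exact: measurableD.
have mQIA : measurable (Q `&` A) by exact: measurableI.
(* The part of [Q] outside [A] has at least half the measure of [Q], hence of [E], which turns
   [l / 4] into [l / 8]. *)
apply: (@le_trans _ _ (l / 4 * fine (mu (Q `\` A)))); last first.
  apply: lower => //; first by lra.
  by move=> x /hA lh; rewrite ler0_norm; lra.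
have : mu Q = (mu (Q `\` A) + mu (Q `&` A))%E by exact: measureDI.
move: A2; rewrite -(fineK Qfin) -(fineK (subfin _ mQA (@subDsetl _ _ _))).
rewrite -(fineK (subfin _ mQIA (@subIsetl _ _ _))) -EFinD -EFinM lee_fin.
by move=> h2 [qE]; rewrite (_ : l / 8 = l / 4 * 2^-1); [nra|by field].
Qed.

Section CalderonZygmund.
Context {R : realType} {d : measure_display} {T : measurableType d}.
Variables (mu om : {measure set T -> \bar R}) (D c : R) (C : int -> set (set T)).
Hypotheses (grid : dyadic_grid mu D C) (D1 : 1 <= D) (c1 : 1 <= c).
Hypothesis om_ac : forall E, measurable E -> mu E = 0%E -> om E = 0%E.
(** The [A_infinity] property at the threshold [1 / (2 * D)]: it serves dense cubes and, because
    [D >= 1], halves of cubes. *)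
Hypothesis om_lower : forall n Q E, C n Q -> measurable E -> E `<=` Q ->
  (mu Q <= (2 * D)%:E * mu E)%E -> (om Q <= c%:E * om E)%E.
Hypothesis om_gt0 : forall n Q, C n Q -> (0 < om Q)%E.
Hypothesis om_lty : forall n Q, C n Q -> (om Q < +oo)%E.

Implicit Types (A E P Q : set T) (n m : int).

Let D0 : 0 < D. Proof. exact: lt_le_trans ltr01 _. Qed.
Let c0 : 0 < c. Proof. exact: lt_le_trans ltr01 _. Qed.
Let D2_gt0 : 0 < 2 * D. Proof. by rewrite mulr_gt0. Qed.

Let mC n Q : C n Q -> measurable Q. Proof. exact: (dg_measurable grid). Qed.

Lemma cube_ancestor (k : nat) n Q : C n Q ->
  exists2 P, C (n - Posz k) P & Q `<=` P.
Proof.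
move=> CQ; elim: k => [|k [P CP QP]]; first by exists Q; rewrite ?subr0.
have [P' CP' PP'] := dg_parent grid CP; exists P'; last exact: subset_trans PP'.
by move: CP'; rewrite -addrA -opprD -[(_ + 1)%R]/(Posz (k + 1)%N) addn1.
Qed.

(** The ancestor of [Q] in the generation of [P] meets [P], hence equals [P] by disjointness. *)
Lemma cube_nested n m Q P : C n Q -> C m P -> m <= n -> Q `&` P !=set0 ->
  Q `<=` P.
Proof.
move=> CQ CP mn [x [Qx Px]].
have [k nE] : exists k : nat, m = n - Posz k.
  by exists `|n - m|%N; rewrite gez0_abs ?subr_ge0// subKr.
have [P' CP' QP'] := cube_ancestor k CQ; rewrite -nE in CP'.
suff -> : P = P' by [].
by apply: (dg_disjoint grid CP CP'); exists x; split => //; exact: QP'.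
Qed.

(** The threshold is fitted to doubling: passing to a parent costs a factor [D], so a cube with a
    non-dense parent is at most half filled by [A]. *)
Definition dense_cube A Q : Prop := (mu Q <= (2 * D)%:E * mu (Q `&` A))%E.

(** Maximality refers to generations rather than to inclusion, since one set may be a cube of
    several generations. *)
Definition stopping_cubes A : set (set T) := [set P | exists n,
  [/\ C n P, dense_cube A P &
      forall m P', m < n -> C m P' -> P `<=` P' -> ~ dense_cube A P']].

Definition stopping_terminates A : Prop :=
  forall n Q, C n Q -> dense_cube A Q -> exists n0, forall m P,
    m <= n0 -> C m P -> Q `<=` P -> ~ dense_cube A P.

Lemma countable_stopping_cubes A : countable (stopping_cubes A).
Proof.
apply: (@sub_countable _ _ _ (\bigcup_n C n)).
  by apply: subset_card_le => P [n [CP _ _]]; exists n.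
by apply: bigcup_countable => // n _; exact: (dg_countable grid).
Qed.

Lemma trivIset_stopping_cubes A : trivIset (stopping_cubes A) id.
Proof.
move=> P P' [n [CP dP stP]] [m [CP' dP' stP']] PP'.
have [nm|mn|nm] := ltgtP n m.
- case: (stP' _ _ nm CP _ dP); apply: (cube_nested CP' CP (ltW nm)).
  by rewrite setIC.
- by case: (stP _ _ mn CP' _ dP'); exact: (cube_nested CP CP' (ltW mn)).
- by subst m; exact: (dg_disjoint grid CP CP').
Qed.

Lemma stopping_cube_half A P : measurable A -> stopping_cubes A P ->
  (2%:E * mu (P `&` A) <= mu P)%E.
Proof.
move=> mA [n [CP dP stP]]; have [P' CP' PP'] := dg_parent grid CP.
have : ~ dense_cube A P' by apply: stP CP' PP'; rewrite ltrBlDr ltrDl.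
rewrite /dense_cube => /negP; rewrite -ltNge => /ltW le1.
have le2 := dg_doubling grid CP CP' PP'.
have le3 : (mu (P `&` A) <= mu (P' `&` A))%E.
  apply: le_measure; rewrite ?inE; last exact: setSI.
    by apply: measurableI => //; exact: mC CP.
  by apply: measurableI => //; exact: mC CP'.
rewrite -(@lee_pmul2l _ D%:E)//.
apply: le_trans le2; rewrite muleA -EFinM mulrC; apply: le_trans le1.
by apply: lee_wpmul2l => //; rewrite lee_fin ltW.
Qed.

Lemma stopping_cubes_cover A : measurable A -> stopping_terminates A ->
  mu.-negligible (A `\` \bigcup_(Q in stopping_cubes A) Q).
Proof.
move=> mA term; apply: negligibleS (dg_density grid mA) => x [Ax nx]; split => //.
move=> [n [Q [CQ Qx Qd]]]; apply: nx.
have dQ : dense_cube A Q.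
  apply: (le_trans Qd); rewrite lee_wpmul2r// lee_fin.
  by rewrite ler_pMr.
have [n0 nd] := term _ _ CQ dQ.
(* [p k] says that the ancestor [k] generations up is dense. Termination bounds such [k], and the
   largest one gives the stopping cube containing [x]. *)
pose p k := `[< exists P, [/\ C (n - Posz k) P, Q `<=` P & dense_cube A P] >].
have p0 : exists k, p k by exists 0%N; apply/asboolP; exists Q; split => //; rewrite subr0.
have pmax k : p k -> (k <= `|n - n0|)%N.
  move=> /asboolP[P [CP QP dP]]; rewrite leqNgt; apply/negP => kgt.
  apply: (nd _ _ _ CP QP dP).
  have : n - n0 <= Posz k.
    by apply: le_trans (ler_norm _) _; rewrite -abszE lez_nat ltnW.
  by rewrite lerBlDr -lerBlDl.
have [k /asboolP[P [CP QP dP]] kmax] := ex_maxnP p0 pmax.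
exists P; last exact: QP; exists (n - Posz k); split => // m P' mk CP' PP' dP'.
have : p `|n - m|%N.
  apply/asboolP; exists P'; split => //; last exact: subset_trans PP'.
  rewrite gez0_abs ?subKr// subr_ge0 (le_trans (ltW mk))// lerBlDr lerDl.
  exact: le0z_nat.
move=> /kmax; rewrite leqNgt => /negP; apply.
rewrite -ltz_nat gez0_abs; first by rewrite ltrBrDl -ltrBrDr.
rewrite subr_ge0 (le_trans (ltW mk))// lerBlDr lerDl.
exact: le0z_nat.
Qed.

Definition decay : R := 1 - c^-1.

Lemma decay_ge0 : 0 <= decay.
Proof. by rewrite subr_ge0 invf_le1. Qed.

Lemma decay_lt1 : decay < 1.
Proof. by rewrite ltrBlDr ltrDl invr_gt0. Qed.

Let subfin (m : {measure set T -> \bar R}) E F : measurable E -> measurable F ->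
  (m F < +oo)%E -> E `<=` F -> m E \is a fin_num.
Proof.
move=> mE mF Ffin EF; rewrite ge0_fin_numE//.
by rewrite (le_lt_trans (le_measure m _ _ EF)) ?inE.
Qed.

(** The complement of [E] fills at least half of [Q], so [om_lower] gives it at least the fraction
    [1 / c] of [om Q]. *)
Lemma half_decay n Q E : C n Q -> measurable E -> E `<=` Q ->
  (2%:E * mu E <= mu Q)%E -> (om E <= decay%:E * om Q)%E.
Proof.
move=> CQ mE EQ E2; have mQ := mC CQ.
have mQE : measurable (Q `\` E) by exact: measurableD.
have splitQ (m : {measure set T -> \bar R}) : m Q = (m E + m (Q `\` E))%E.
  by rewrite addeC -{2}(setIidr EQ) -measureDI.
have Qoo := dg_lty grid CQ; have oQoo := om_lty CQ.
have muE := subfin mE mQ Qoo EQ; have omE := subfin mE mQ oQoo EQ.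
have muQ := subfin mQ mQ Qoo (@subset_refl _ _).
have omQ := subfin mQ mQ oQoo (@subset_refl _ _).
have muD := subfin mQE mQ Qoo (@subDsetl _ _ _).
have omD := subfin mQE mQ oQoo (@subDsetl _ _ _).
have : (om Q <= c%:E * om (Q `\` E))%E.
  apply: (om_lower CQ) => //.
  move: (splitQ mu) E2; rewrite -(fineK muQ) -(fineK muE) -(fineK muD).
  rewrite -EFinD -!EFinM !lee_fin => -[->] h.
  have := fine_ge0 (measure_ge0 mu (Q `\` E)).
  by move: D1 h; nra.
move: (splitQ om); rewrite -(fineK omQ) -(fineK omE) -(fineK omD).
rewrite -EFinD -!EFinM !lee_fin => -[qE] h.
rewrite /decay mulrBl mul1r lerBrDl addrC -lerBrDl.
rewrite mulrC ler_pdivrMr// mulrC.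
by have <- : fine (om (Q `\` E)) = fine (om Q) - fine (om E) by rewrite qE; ring.
Qed.

Lemma measurable_stopping_cubes A : measurable (\bigcup_(Q in stopping_cubes A) Q).
Proof.
apply: measurable_countable_bigcup; first exact: countable_stopping_cubes.
by move=> Q [n [CQ _ _]]; exact: mC CQ.
Qed.

(* Passing from [E] to the union of the maximal cubes where [E] is dense
   multiplies [mu] by at most [2 * D] and [om] by at least [decay^-1]. *)
Lemma density_decay (k : nat) n Q E : C n Q -> measurable E -> E `<=` Q ->
  (((2 * D) ^+ k)%:E * mu E < mu Q)%E -> (om E <= (decay ^+ k)%:E * om Q)%E.
Proof.
move=> CQ; elim: k E => [|k IH] E mE EQ Esmall.
  by rewrite expr0 mul1e; apply: le_measure; rewrite ?inE//; exact: mC CQ.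
have small1 : ((2 * D)%:E * mu E < mu Q)%E.
  apply: le_lt_trans Esmall; rewrite lee_wpmul2r// lee_fin exprS ler_pMr//.
  by rewrite exprn_ege1//; move: D1; lra.
have dense_meet P : (exists m, C m P) -> dense_cube E P -> P `&` Q !=set0.
  move=> [m CP] dP; apply/set0P/negP => /eqP PQ0.
  have PE : P `&` E = set0 by apply/seteqP; split => // x [Px /EQ Qx]; rewrite -PQ0.
  by have := dg_gt0 grid CP; rewrite ltNge => /negP; apply; move: dP;
    rewrite /dense_cube PE measure0 mule0.
(* As [E] fills less than [1 / (2 * D)] of [Q], no cube containing [Q] is dense; the stopping
   procedure therefore terminates and its cubes stay inside [Q]. *)
have ndense m P : C m P -> Q `<=` P -> ~ dense_cube E P.
  move=> CP QP dP; have : (mu Q <= (2 * D)%:E * mu E)%E.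
    apply: (@le_trans _ _ (mu P)).
      by apply: le_measure; rewrite ?inE//; [exact: mC CQ|exact: mC CP].
    apply: (le_trans dP); apply: lee_wpmul2l; first by rewrite lee_fin ltW.
    apply: le_measure; rewrite ?inE//; first by apply: measurableI => //; exact: mC CP.
  by rewrite leNgt small1.
have term : stopping_terminates E.
  move=> m P CP dP; exists n => m' P' m'n CP' PP' dP'.
  apply: (ndense _ _ CP' _ dP'); apply: (cube_nested CQ CP' m'n).
  have [x [Px Qx]] : P `&` Q !=set0 by apply: dense_meet => //; exists m.
  by exists x; split => //; exact: PP'.
set F := stopping_cubes E; set U := \bigcup_(P in F) P.
have mU : measurable U by exact: measurable_stopping_cubes.
have cF := countable_stopping_cubes E; have tF := @trivIset_stopping_cubes E.
have mF P : F P -> measurable P by move=> [m [CP _ _]]; exact: mC CP.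
have UQ : U `<=` Q.
  move=> x [P [m [CP dP _]] Px].
  have PQ : P `&` Q !=set0 by apply: dense_meet => //; exists m.
  have [nm|mn] := leP n m; first exact: (cube_nested CP CQ nm PQ).
  case: (ndense _ _ CP _ dP); apply: (cube_nested CQ CP (ltW mn)).
  by rewrite setIC.
have Ucover : om (E `\` U) = 0%E.
  apply: om_ac; first exact: measurableD.
  apply: measure_negligible; first exact: measurableD.
  exact: stopping_cubes_cover.
have muU : (mu U <= (2 * D)%:E * mu E)%E.
  have := @le_measure_bigcup _ _ _ mu mu F setT E (2 * D) cF tF mF measurableT mE.
  rewrite setIT => /(_ (ltW D2_gt0))/(_ _)/wrap[].
    by move=> P [m [_ dP _]]; rewrite setIT.
  move/le_trans; apply; apply: lee_wpmul2l; first by rewrite lee_fin ltW.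
  by apply: le_measure; rewrite ?inE//; exact: measurableI.
have omU : (om E <= decay%:E * om U)%E.
  have -> : om E = om (U `&` E).
    by rewrite setIC -[RHS]add0e -Ucover; exact: measureDI.
  have := @le_measure_bigcup _ _ _ om om F E setT decay cF tF mF mE measurableT.
  rewrite setIT => /(_ decay_ge0)/(_ _)/wrap[]; last exact.
  move=> P FP; rewrite setIT; have [m [CP dP _]] := FP.
  apply: (half_decay CP) => //; first by apply: measurableI => //; exact: mF.
  exact: stopping_cube_half.
apply: (le_trans omU); rewrite exprS EFinM -muleA.
apply: lee_wpmul2l; first by rewrite lee_fin decay_ge0.
apply: IH => //; apply: le_lt_trans Esmall; rewrite exprSr EFinM -muleA.
by apply: lee_wpmul2l => //; rewrite lee_fin exprn_ge0// ltW.
Qed.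

Lemma exists_pow_lt (a b e : R) : 0 <= a < 1 -> 0 < e -> exists k, a ^+ k * b < e.
Proof.
move=> /andP[a0 a1] e0.
have /cvgr0_norm_lt/(_ (e / (`|b| + 1))) : a ^+ n @[n --> \oo] --> (0 : R).
  by apply: cvg_expr; rewrite ger0_norm.
have b1 : 0 < `|b| + 1 by rewrite ltr_wpDl.
rewrite divr_gt0// => /(_ isT)[k _ /(_ k (leqnn k))/=].
rewrite ger0_norm ?exprn_ge0// ltr_pdivlMr// => ak; exists k.
apply: le_lt_trans ak; apply: ler_wpM2l; first exact: exprn_ge0.
by apply: (le_trans (ler_norm _)); rewrite lerDl.
Qed.

Lemma calderon_zygmund A : measurable A -> (om A < +oo)%E ->
  ((mu setT < +oo)%E -> (2%:E * mu A <= mu setT)%E) ->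
  exists F : set (set T),
  [/\ countable F /\ trivIset F id,
      forall Q, F Q -> exists n, C n Q,
      forall Q, F Q -> dense_cube A Q,
      forall Q, F Q -> (2%:E * mu (Q `&` A) <= mu Q)%E &
      mu.-negligible (A `\` \bigcup_(Q in F) Q)].
Proof.
move=> mA Aoo half.
have fromterm : stopping_terminates A -> exists F : set (set T),
  [/\ countable F /\ trivIset F id,
      forall Q, F Q -> exists n, C n Q,
      forall Q, F Q -> dense_cube A Q,
      forall Q, F Q -> (2%:E * mu (Q `&` A) <= mu Q)%E &
      mu.-negligible (A `\` \bigcup_(Q in F) Q)].
  move=> term; exists (stopping_cubes A); split.
  - split; [exact: countable_stopping_cubes|exact: trivIset_stopping_cubes].
  - by move=> Q [n [CQ _ _]]; exists n.
  - by move=> Q [n [_ dQ _]].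
  - by move=> Q; exact: stopping_cube_half.
  - exact: stopping_cubes_cover.
have [Xoo|Xoo] := ltP (mu setT) +oo%E.
  have [n CX] := dg_top grid Xoo.
  have [dX|ndX] := pselect (dense_cube A setT).
    (* All cubes of earlier generations equal [setT], so a dense [setT] has no first generation. It
       forms the family by itself, with [half] in place of maximality. *)
    exists [set setT]; split.
    - by split; [exact: countable1|exact: trivIset1].
    - by move=> _ ->; exists n.
    - by move=> _ ->.
    - by move=> _ ->; rewrite setTI; exact: half.
    - by rewrite bigcup_set1 setDT; exact: negligible_set0.
  (* A cube of generation at most [n] meets the cube [setT], hence contains it, and [setT] is not
     dense here. *)
  apply: fromterm => m Q CQ _; exists n => m' P m'n CP QP.
  suff -> : P = setT by [].
  apply/seteqP; split => //; apply: (cube_nested CX CP m'n).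
  have [x Px] : P !=set0.
    apply/set0P/negP => /eqP P0; have := dg_gt0 grid CP.
    by rewrite P0 measure0 ltxx.
  by exists x.
have {}Xoo : mu setT = +oo%E by apply/eqP; rewrite -leye_eq.
apply: fromterm => n Q CQ _; have mQ := mC CQ.
have Afin : om A \is a fin_num by rewrite ge0_fin_numE.
have oQfin : om Q \is a fin_num by rewrite ge0_fin_numE// (om_lty CQ).
have Qfin : mu Q \is a fin_num by rewrite ge0_fin_numE// (dg_lty grid CQ).
have oQ0 : 0 < fine (om Q) by rewrite fine_gt0// (om_gt0 CQ) (om_lty CQ).
(* With this [k], a remote dense ancestor [P] of [Q] is impossible: [om Q <= decay ^+ k * om P <=
   decay ^+ k * c * om A < om Q]. The generation [n0] makes [mu P] large enough for
   [density_decay]. *)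
have [|k kA] := @exists_pow_lt decay (c * fine (om A)) _ _ oQ0.
  by rewrite decay_ge0 decay_lt1.
have [n0 n0P] := dg_exhaust grid Xoo CQ ((2 * D) ^+ k * fine (mu Q) + 1).
exists n0 => m P mn CP QP dP.
have h1 : (om Q <= (decay ^+ k)%:E * om P)%E.
  apply: (density_decay CP) => //; apply: lt_le_trans (n0P _ _ mn CP QP).
  by rewrite -(fineK Qfin) -EFinM lte_fin ltrDl.
have h2 : (om P <= c%:E * om A)%E.
  apply: (@le_trans _ _ (c%:E * om (P `&` A))%E).
    apply: (om_lower CP) => //.
    by apply: measurableI => //; exact: mC CP.
  apply: lee_wpmul2l; first by rewrite lee_fin ltW.
  by apply: le_measure; rewrite ?inE//; apply: measurableI => //; exact: mC CP.
have : (om Q <= (decay ^+ k)%:E * (c%:E * om A))%E.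
  apply: (le_trans h1); apply: lee_wpmul2l => //.
  by rewrite lee_fin exprn_ge0// decay_ge0.
rewrite -(fineK oQfin) -(fineK Afin) -!EFinM lee_fin leNgt => /negP; exact.
Qed.

Lemma good_lambda (f g v : T -> R) (l : R) (k : nat) :
  measurable_fun setT f -> measurable_fun setT g -> measurable_fun setT v ->
  (forall x, `|f x| <= v x) ->
  (forall n Q, C n Q -> exists fQ : T -> R,
     [/\ mu.-integrable Q (EFin \o fQ),
         (forall x, Q x -> `|f x| <= fQ x <= v x) &
         (forall y, Q y ->
            average mu Q (fun x => `|fQ x - average mu Q fQ|) <= g y)]) ->
  0 < l -> (om [set x | (l / 4 < v x)%R] < +oo)%E ->
  ((mu setT < +oo)%E -> (2%:E * mu [set x | (l / 4 < v x)%R] <= mu setT)%E) ->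
  (om [set x | (l < `|f x|)%R] <=
     (decay ^+ k * c)%:E * om [set x | (l / 4 < v x)%R] +
     om [set x | (((2 * D) ^+ k * 16)^-1 * l < `|g x|)%R])%E.
Proof.
move=> mf mg mv fv osc l0 Aoo half.
set A := [set x | l / 4 < v x] in Aoo half *.
set G := [set x | _ < `|g x| ]; set S := [set x | l < `|f x|].
have mA : measurable A by exact: measurable_superlevel.
have mS : measurable S by apply: measurable_superlevel; exact: measurableT_comp.
have mG : measurable G by apply: measurable_superlevel; exact: measurableT_comp.
have SA : S `<=` A by move=> x; rewrite /S/A/= => lf; have := fv x; move: l0 lf; lra.
have [F [[cF tF] FC dF hF coverF]] := calderon_zygmund mA Aoo half.
have mF Q : F Q -> measurable Q by move=> /FC[n]; exact: mC.
set U := \bigcup_(Q in F) Q in coverF.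
have mU : measurable U by exact: measurable_countable_bigcup.
have mSG : measurable (S `\` G) by exact: measurableD.
have leQ Q : F Q -> (om (Q `&` (S `\` G)) <= (decay ^+ k * c)%:E * om (Q `&` A))%E.
  move=> FQ; have [n CQ] := FC _ FQ; have mQ := mC CQ.
  (* Either [Q] contributes nothing, or one point [y] with [|g y| <= gam * l] controls the
     oscillation on the whole cube. *)
  have [->|/set0P[y [Qy [Sy Gy]]]] := eqVneq (Q `&` (S `\` G)) set0.
    rewrite measure0 mule_ge0// lee_fin mulr_ge0 ?exprn_ge0 ?decay_ge0//.
    exact: ltW.
  have [fQ [iQ fQv oscQ]] := osc _ _ CQ.
  have gy : g y <= ((2 * D) ^+ k * 16)^-1 * l.
    by apply: (le_trans (ler_norm _)); rewrite leNgt; apply/negP.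
  have {oscQ} := le_trans (oscQ _ Qy) gy.
  have Qoo := dg_lty grid CQ; have Q0 := dg_gt0 grid CQ.
  have := @oscillation_lower _ _ _ mu Q A (Q `&` S) fQ (average mu Q fQ) l mQ Q0
    Qoo mA (measurableI _ _ mQ mS) (@subIsetl _ _ _) (hF _ FQ) iQ l0.
  move=> /(_ _ _)/wrap[||h1 h2].
  - move=> x [Qx Ax]; have /andP[_ fQx] := fQv _ Qx.
    by apply: (le_trans fQx); rewrite leNgt; apply/negP.
  - move=> x [Qx Sx]; have /andP[fQx _] := fQv _ Qx; exact: lt_le_trans fQx.
  apply: (@le_trans _ _ (om (Q `&` S))).
    apply: le_measure; rewrite ?inE; [exact: measurableI|exact: measurableI|].
    by apply: setIS; exact: subDsetl.
  have mQS : measurable (Q `&` S) by exact: measurableI.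
  apply: (@le_trans _ _ ((decay ^+ k)%:E * om Q)%E).
    apply: (density_decay CQ) => //.
    have Qfin := subfin mQ mQ Qoo (@subset_refl _ _).
    have QSfin := subfin mQS mQ Qoo (@subIsetl _ _ _).
    have fQ0 : 0 < fine (mu Q) by rewrite fine_gt0// Q0.
    rewrite -(fineK Qfin) -(fineK QSfin) -EFinM lte_fin.
    have P0 : 0 < (2 * D) ^+ k by rewrite exprn_gt0.
    set P := (2 * D) ^+ k in h2 P0 *.
    (* The constant [16] bounds the density of [S] in [Q] by [1 / (2 * P)]; the spare [2] gives the
       strict inequality that [density_decay] needs. *)
    have : l / 8 * fine (mu (Q `&` S)) <= fine (mu Q) * ((P * 16)^-1 * l).
      by apply: (le_trans h1); rewrite ler_pM2l.
    have -> : fine (mu Q) * ((P * 16)^-1 * l) = l / 8 * (fine (mu Q) / (2 * P)).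
      by field; rewrite gt_eqF.
    rewrite ler_pM2l ?divr_gt0// ler_pdivlMr ?mulr_gt0//; lra.
  rewrite EFinM -muleA; apply: lee_wpmul2l; first by rewrite lee_fin exprn_ge0// decay_ge0.
  by apply: (om_lower CQ) => //; [exact: measurableI|exact: dF].
have null : om (S `\` G `\` U) = 0%E.
  apply: om_ac; first exact: measurableD.
  apply: measure_negligible; first exact: measurableD.
  by apply: negligibleS coverF => x [[Sx _] nU]; split => //; exact: SA.
have K0 : 0 <= decay ^+ k * c by rewrite mulr_ge0 ?exprn_ge0 ?decay_ge0// ltW.
have leSG : (om (S `\` G) <= (decay ^+ k * c)%:E * om A)%E.
  have -> : om (S `\` G) = om (U `&` (S `\` G)).
    by rewrite setIC -[RHS]add0e -null; exact: measureDI.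
  apply: le_trans (le_measure_bigcup cF tF mF mSG mA K0 leQ) _.
  apply: lee_wpmul2l => //; apply: le_measure; rewrite ?inE//.
  exact: measurableI.
have -> : om S = (om (S `\` G) + om (S `&` G))%E by exact: measureDI.
apply: leeD => //; apply: le_measure; rewrite ?inE//; exact: measurableI.
Qed.

End CalderonZygmund.

(** * Summation over dyadic levels *)

Section DyadicLayers.
Context {R : realType}.
Variable p : R.
Hypothesis p1 : 1 < p.
Implicit Types (s t a : R) (n : nat).

Let p0 : 0 < p. Proof. exact: lt_trans p1. Qed.

Let two_powR : 2 <= 2 `^ p :> R.
Proof. by apply: le1r_powR; [rewrite ler1n|exact: ltW]. Qed.

Definition level s (j : nat) : R := 2 ^+ j * s.

Let level_gt0 s j : 0 < s -> 0 < level s j.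
Proof. by move=> s0; rewrite mulr_gt0// exprn_gt0. Qed.

Let levelS s j : 0 < s -> (level s j.+1) `^ p = 2 `^ p * (level s j) `^ p.
Proof. by move=> s0; rewrite /level exprS -mulrA powRM// ltW// level_gt0. Qed.

(** The terms grow by the ratio [2 ^ p >= 2], so each exceeds the sum of its predecessors. *)
Lemma sum_level_le s n : 0 < s ->
  \sum_(j < n) (level s j) `^ p <= (level s n) `^ p.
Proof.
move=> s0; elim: n => [|n IH]; first by rewrite big_ord0 powR_ge0.
rewrite big_ord_recr levelS//=.
have := powR_ge0 (level s n) p; move: IH two_powR; nra.
Qed.

(** The level after the last one below [t] is less than [2 * t], and its power dominates the sum. *)
Lemma sum_level_lt s t n : 0 < s -> 0 <= t ->
  \sum_(j < n) (level s j) `^ p * (level s j < t)%R%:R <= (2 * t) `^ p.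
Proof.
move=> s0 t0; elim: n => [|n IH]; first by rewrite big_ord0 powR_ge0.
rewrite big_ord_recr/=; have [nt|_] := ltP (level s n) t; last first.
  by rewrite mulr0 addr0.
apply: (@le_trans _ _ (\sum_(j < n.+1) (level s j) `^ p)).
  rewrite big_ord_recr/= mulr1 lerD2r; apply: ler_sum => j _.
  by apply: ler_piMr; [exact: powR_ge0|case: (_ < _)].
apply: (le_trans (sum_level_le n.+1 s0)).
apply: ge0_ler_powR; rewrite ?nnegrE ?(ltW p0) ?(ltW (level_gt0 _ s0))//.
  by rewrite mulr_ge0.
by rewrite /level exprS -mulrA ler_pM2l// ltW.
Qed.

(** The largest level below [t] is at least [t / 2], and its term alone suffices. *)
Lemma powR_le_sum_level s t n : 0 < s -> s < t -> t <= level s n ->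
  t `^ p <= 2 `^ p * \sum_(j < n) (level s j) `^ p * (level s j < t)%R%:R.
Proof.
move=> s0 st; elim: n => [|n IH].
  by rewrite /level expr0 mul1r leNgt st.
move=> tn; rewrite big_ord_recr/=; have [nt|/IH h] := ltP (level s n) t.
  rewrite mulr1 mulrDr -levelS//; apply: ler_wpDl.
    rewrite mulr_ge0 ?powR_ge0//; apply: sumr_ge0 => j _.
    by rewrite mulr_ge0 ?powR_ge0.
  apply: ge0_ler_powR; rewrite ?nnegrE ?(ltW p0) ?(ltW (level_gt0 _ s0))//.
  exact/ltW/(lt_trans s0).
by rewrite mulr0 addr0.
Qed.

End DyadicLayers.

Section WeightedLayers.
Context {R : realType} {d : measure_display} {T : measurableType d}.
Variables (mu om : {measure set T -> \bar R}) (w : T -> R) (p : R).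
Hypotheses (p1 : 1 < p) (mw : measurable_fun setT w) (w0 : forall x, 0 <= w x).
Hypothesis omE : forall A, om A = (\int[mu]_(x in A) (w x)%:E)%E.
Implicit Types u f g v : T -> R.

Let p0 : 0 < p. Proof. exact: lt_trans p1. Qed.

Definition wint u : \bar R := (\int[mu]_x (`|u x| `^ p * w x)%:E)%E.

Lemma wint_ge0 u : (0 <= wint u)%E.
Proof. by apply: integral_ge0 => x _; rewrite lee_fin mulr_ge0// powR_ge0. Qed.

Let mlevel u (l : R) : measurable_fun setT u -> measurable [set x | l < `|u x|].
Proof. by move=> m_u; apply: measurable_superlevel; exact: measurableT_comp. Qed.

Let mlevelb u (l : R) : measurable_fun setT u ->
  measurable_fun setT (fun x => (l < `|u x|)%R%:R : R).
Proof.
move=> m_u; rewrite (_ : (fun x => _) = \1_[set x | l < `|u x|]).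
  exact/measurable_indic/mlevel.
by apply/funext => x; rewrite indicE; congr ((nat_of_bool _)%:R);
  apply/idP/idP; rewrite inE.
Qed.

Let mlevels u (s : R) n : measurable_fun setT u -> measurable_fun setT
  (fun x => \sum_(j < n) level s j `^ p * (level s j < `|u x|)%R%:R).
Proof.
move=> m_u; apply: measurable_sum => j; apply: measurable_funM => //.
exact: mlevelb.
Qed.

Lemma measurable_wint u : measurable_fun setT u ->
  measurable_fun setT (fun x => `|u x| `^ p * w x).
Proof.
move=> m_u; apply: measurable_funM => //.
by apply: (measurableT_comp (measurable_powR p)); exact: measurableT_comp.
Qed.

Let om_indic A : measurable A -> om A = (\int[mu]_x ((x \in A)%:R * w x)%:E)%E.
Proof.
move=> mA; rewrite omE integral_mkcond; apply: eq_integral => x _.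
by rewrite patchE; case: ifP => _; rewrite ?mul1r ?mul0r.
Qed.

(** A finite, discrete layer-cake formula: the measures are integrals of indicators, and the sum
    moves inside. *)
Lemma sum_measure_level u (s : R) n : measurable_fun setT u ->
  (\sum_(j < n) (level s j `^ p)%:E * om [set x | (level s j < `|u x|)%R] =
   \int[mu]_x ((\sum_(j < n) level s j `^ p * (level s j < `|u x|)%R%:R) * w x)%:E)%E.
Proof.
move=> m_u.
transitivity (\sum_(j < n) \int[mu]_x (level s j `^ p * (level s j < `|u x|)%R%:R * w x)%:E)%E.
  apply: eq_bigr => j _; rewrite om_indic; last exact: mlevel.
  rewrite -ge0_integralZl_EFin//.
  - apply: eq_integral => x _; rewrite -EFinM mulrA.
    by rewrite (_ : (x \in _) = (level s j < `|u x|)); last by apply/idP/idP; rewrite inE.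
  - by move=> x _; rewrite lee_fin mulr_ge0.
  - apply/measurable_EFinP/measurable_funM => //; exact/measurable_indic/mlevel.
  - exact: powR_ge0.
rewrite -ge0_integral_sum//.
- by apply: eq_integral => x _; rewrite sumEFin mulr_suml.
- move=> j; apply/measurable_EFinP/measurable_funM => //.
  by apply: measurable_funM => //; exact: mlevelb.
- by move=> j x _; rewrite lee_fin !mulr_ge0 ?powR_ge0.
Qed.

Lemma sum_measure_level_le u (s a : R) n : measurable_fun setT u -> 0 < s -> 0 < a ->
  (\sum_(j < n) (level s j `^ p)%:E * om [set x | (a * level s j < `|u x|)%R] <=
   ((2 / a) `^ p)%:E * wint u)%E.
Proof.
move=> m_u s0 a0; have mua : measurable_fun setT (fun x => a^-1 * u x).
  exact: measurable_funM.
have ua x : `|a^-1 * u x| = `|u x| / a.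
  by rewrite normrM gtr0_norm ?invr_gt0// mulrC.
have -> : (\sum_(j < n) (level s j `^ p)%:E * om [set x | (a * level s j < `|u x|)%R] =
  \sum_(j < n) (level s j `^ p)%:E * om [set x | (level s j < `|a^-1 * u x|)%R])%E.
  apply: eq_bigr => j _; congr (_ * om _)%E; apply/seteqP.
  by split => x /=; rewrite ua ltr_pdivlMr// mulrC.
rewrite (sum_measure_level _ _ mua) /wint -ge0_integralZl_EFin ?powR_ge0//.
- apply: ge0_le_integral => //.
  + move=> x _; rewrite lee_fin mulr_ge0//; apply: sumr_ge0 => j _.
    by rewrite mulr_ge0 ?powR_ge0.
  + apply/measurable_EFinP/measurable_funM => //.
    exact: mlevels.
  + apply/measurable_EFinP/measurable_funM => //; exact: measurable_wint.
  + move=> x _; rewrite -EFinM lee_fin mulrA ler_wpM2r//.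
    apply: (le_trans (sum_level_lt p1 _ s0 (normr_ge0 _))).
    by rewrite ua mulrA mulrAC powRM// divr_ge0// ltW.
- by move=> x _; rewrite lee_fin mulr_ge0 ?powR_ge0.
- exact/measurable_EFinP/measurable_wint.
Qed.

(** On the set [A m], where [|f|] is [0] or lies between [2 ^ (-m)] and [2 ^ m], finitely many
    levels control [|f| ^ p]. These sets increase to the whole space, and continuity from below of
    the measure with density [|f| ^ p * w] concludes. *)
Lemma wint_le_levels f (K : \bar R) : measurable_fun setT f ->
  (forall s n, 0 < s -> (\sum_(j < n) (level s j `^ p)%:E *
     om [set x | (level s j < `|f x|)%R] <= K)%E) ->
  (wint f <= (2 `^ p)%:E * K)%E.
Proof.
move=> mf leK.
have fpw0 x : 0 <= `|f x| `^ p * w x by rewrite mulr_ge0 ?powR_ge0.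
have [nu nuE] := exists_density_measure mu (measurable_wint mf) fpw0.
pose s m : R := (2 ^+ m)^-1.
have s0 m : 0 < s m by rewrite invr_gt0 exprn_gt0.
pose L l := [set x | l < `|f x|].
pose A m := ~` L (2 ^+ m) `\` (L 0 `\` L (s m)).
have mL l : measurable (L l) by exact: mlevel.
have mA m : measurable (A m).
  by apply: measurableD; [exact: measurableC|exact: measurableD].
have AP m x : A m x <-> `|f x| <= 2 ^+ m /\ (`|f x| = 0 \/ s m < `|f x|).
  rewrite /A/L/=; split.
    move=> [/negP]; rewrite -leNgt => f2 /not_andP h; split => //.
    case: h => [/negP|/contrapT h]; last by right.
    by rewrite -leNgt => h; left; apply/eqP; rewrite eq_le h normr_ge0.
  move=> [f2 h]; split; first by apply/negP; rewrite -leNgt.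
  by move=> [f0 fs]; case: h => // h; rewrite h ltxx in f0.
have Acvg : nu (A m) @[m --> \oo] --> nu setT.
  have -> : [set: T] = \bigcup_m A m.
    apply/seteqP; split => // x _.
    have [fx0|fx0] := eqVneq `|f x| 0.
      by exists 0%N => //; apply/AP; split; [rewrite fx0|left].
    have {}fx0 : 0 < `|f x| by rewrite lt_neqAle eq_sym fx0 normr_ge0.
    pose m := maxn (Num.bound `|f x|) (Num.bound `|f x|^-1).
    have pow (y : R) k : 0 <= y -> (Num.bound y <= k)%N -> y < 2 ^+ k.
      move=> y0 yk; apply: (lt_le_trans (archi_boundP y0)).
      by rewrite -natrX ler_nat (leq_trans yk)// ltnW// ltn_expl.
    exists m => //; apply/AP; split; first by apply/ltW/pow; rewrite ?leq_maxl.
    right; rewrite /s -[ltRHS]invrK ltf_pV2 ?posrE ?invr_gt0 ?exprn_gt0//.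
    by apply: pow; rewrite ?invr_ge0 ?leq_maxr.
  apply: nondecreasing_cvg_mu => //; first exact: bigcup_measurable.
  move=> m n mn; apply/subsetPset => x /AP[f2 fs]; apply/AP; split.
    by rewrite (le_trans f2)// ler_eXn2l// ltr1n.
  case: fs => [|fs]; [by left|right; apply: le_lt_trans fs].
  by rewrite /s lef_pV2 ?posrE ?exprn_gt0// ler_eXn2l// ltr1n.
rewrite /wint -nuE -(cvg_lim _ Acvg)//; apply: lime_le.
  by apply/cvg_ex; exists (nu setT).
apply: nearW => m; rewrite nuE.
(* Starting from [2 ^ (-m)], it takes [m + m] doublings to reach [2 ^ m]. *)
apply: (@le_trans _ _ ((2 `^ p)%:E * (\sum_(j < (m + m)%N) (level (s m) j `^ p)%:E *
     om [set x | (level (s m) j < `|f x|)%R]))%E); last first.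
  by apply: lee_wpmul2l; [rewrite lee_fin powR_ge0|exact: leK].
rewrite (sum_measure_level _ _ mf) -ge0_integralZl_EFin ?powR_ge0//; last 2 first.
- move=> x _; rewrite lee_fin mulr_ge0//; apply: sumr_ge0 => j _.
  by rewrite mulr_ge0 ?powR_ge0.
- apply/measurable_EFinP/measurable_funM => //; exact: mlevels.
rewrite integral_mkcond; apply: ge0_le_integral => //.
- by move=> x _; rewrite patchE; case: ifP => // _; rewrite lee_fin.
- apply/(measurable_restrictT _ _).1 => //; apply/measurable_EFinP.
  exact: measurable_funTS (measurable_wint mf).
- apply/measurable_EFinP; apply: measurable_funM => //.
  by apply: measurable_funM => //; exact: mlevels.
- move=> x _; rewrite patchE; case: ifPn => [|_]; last first.
    rewrite -EFinM lee_fin mulr_ge0 ?powR_ge0// mulr_ge0//.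
    by apply: sumr_ge0 => j _; rewrite mulr_ge0 ?powR_ge0.
  rewrite inE => /AP[f2 fs]; rewrite -EFinM lee_fin mulrA ler_wpM2r//.
  case: fs => [->|fs].
    rewrite powR0 ?gt_eqF// mulr_ge0 ?powR_ge0//.
    by apply: sumr_ge0 => j _; rewrite mulr_ge0 ?powR_ge0.
  apply: powR_le_sum_level => //; rewrite /level exprD -mulrA divff ?mulr1 ?gt_eqF// exprn_gt0.
Qed.

(** Multiply the level inequality by [l ^ p] and sum over dyadic [l]. Thresholds [l / 4] and
    [gam * l] give the factors [8 ^ p] and [(2 / gam) ^ p]; the exceptional levels below [l0]
    contribute a geometric sum. *)
Lemma layer_bound f g v (K gam l0 : R) (M : \bar R) :
  measurable_fun setT f -> measurable_fun setT g -> measurable_fun setT v ->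
  0 <= K -> 0 < gam -> 0 <= l0 -> (0 <= M)%E ->
  (forall l, 0 < l -> (om [set x | (l < `|f x|)%R] <=
     K%:E * om [set x | (l / 4 < `|v x|)%R] + om [set x | (gam * l < `|g x|)%R] +
     (if (l < l0)%R then M else 0))%E) ->
  (wint f <= (2 `^ p)%:E * ((K * 8 `^ p)%:E * wint v +
     ((2 / gam) `^ p)%:E * wint g + ((2 * l0) `^ p)%:E * M))%E.
Proof.
move=> mf mg mv K0 gam0 l00 M0 le_om; apply: wint_le_levels => // s n s0.
have le0 (j : nat) : (0 <= (level s j `^ p)%:E)%E by rewrite lee_fin powR_ge0.
have lev0 j : 0 < level s j by rewrite mulr_gt0// exprn_gt0.
apply: (@le_trans _ _ (\sum_(j < n)
   (K%:E * ((level s j `^ p)%:E * om [set x | (4^-1 * level s j < `|v x|)%R]) +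
    (level s j `^ p)%:E * om [set x | (gam * level s j < `|g x|)%R] +
    (level s j `^ p * (level s j < l0)%R%:R)%:E * M))%E).
  apply: lee_sum => j _; apply: (le_trans (lee_wpmul2l (le0 j) (le_om _ (lev0 j)))).
  rewrite !ge0_muleDr ?adde_ge0 ?mule_ge0//; last by case: ifP.
  rewrite [in X in (X + _ + _)%E]muleCA [in X in (X + _ + _)%E](mulrC _ 4^-1).
  rewrite leeD2l// EFinM -muleA; case: ifP => _; first by rewrite mul1e.
  by rewrite mul0e.
rewrite !big_split/=; apply: leeD; [apply: leeD|].
- rewrite -ge0_sume_distrr; last by move=> j _; rewrite mule_ge0.
  rewrite EFinM -muleA; apply: lee_wpmul2l => //.
  have -> : 8 = 2 / 4^-1 :> R by rewrite invrK; ring.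
  by apply: sum_measure_level_le; rewrite ?invr_gt0.
- exact: sum_measure_level_le.
- rewrite -ge0_sume_distrl; last first.
    by move=> j _; rewrite lee_fin mulr_ge0 ?powR_ge0.
  apply: lee_wpmul2r => //; rewrite sumEFin lee_fin.
  exact: sum_level_lt.
Qed.

End WeightedLayers.

(** * Optimization *)

Lemma exists_pow_between (R : realType) (a y : R) : 1 < a -> 1 <= y ->
  exists k : nat, a ^+ k <= y < a ^+ k.+1.
Proof.
move=> a1 y1; have a0 : 0 < a by exact: lt_trans a1.
have y0 : 0 < y by exact: lt_le_trans y1.
have ex : exists k, y < a ^+ k.
  have ia : 0 <= a^-1 < 1 by rewrite invr_ge0 ltW//= invf_lt1.
  have iy : 0 < y^-1 by rewrite invr_gt0.
  have [k] := exists_pow_lt 1 ia iy.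
  by rewrite mulr1 exprVn ltf_pV2 ?posrE ?exprn_gt0// => yk; exists k.
have [k yk kmin] := ex_minnP ex; case: k yk kmin => [|k] yk kmin.
  by move: yk; rewrite expr0 ltNge y1.
exists k; rewrite yk andbT leNgt; apply/negP => /kmin.
by rewrite ltnn.
Qed.

(* Choosing [k] with [A ^+ k] about [sqrt (V / G)] balances the two terms. *)
Lemma optimize_decay (R : realType) (A kap p C : R) :
  1 < A -> 0 <= kap < 1 -> 0 < p -> 0 < C ->
  exists b N : R, [/\ 0 < b, b < p, 0 < N &
  forall F V G L : R, 0 <= V -> 0 <= G -> 0 <= L -> F <= V ->
  (forall k : nat, F <= C * (kap ^+ k * V + A ^+ k * G) + L) ->
  F <= N * (G `^ p^-1) `^ b * (V `^ p^-1) `^ (p - b) + L].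
Proof.
move=> A1 /andP[kap0 kap1] p0 C0; have A0 : 0 < A by exact: lt_trans A1.
(* [kap] may be [0]; the maximum makes [kap'] a genuine negative power of [A], with exponent
   [- sig]. *)
pose kap' := Num.max kap 2^-1.
have kap'0 : 0 < kap' by rewrite lt_max invr_gt0 ltr0n orbT.
have kap'1 : kap' < 1 by rewrite gt_max kap1 invf_lt1// ltr1n.
have lnA : 0 < ln A by rewrite ln_gt0.
pose sig := - ln kap' / ln A.
have sig0 : 0 < sig by rewrite divr_gt0// oppr_gt0 ln_lt0// kap'0.
have kapE : kap' = A `^ (- sig).
  rewrite /powR gt_eqF// /sig mulNr divfK ?gt_eqF// opprK.
  by rewrite lnK// posrE.
(* For [t = G / V < 1] and [A ^+ k] about [t ^ (-1/2)], the growing term is at most [t ^ (1/2)] and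
   the decaying one about [t ^ (sig / 2)], both relative to [V]; the smaller exponent serves for
   both. *)
pose b := Num.min (sig / 2) 2^-1.
have b0 : 0 < b by rewrite lt_min divr_gt0// invr_gt0 ltr0n.
have b1 : b < 1 by rewrite gt_min invf_lt1// ltr1n orbT.
exists (p * b), (C * (kap'^-1 + 1) + 1); split.
- by rewrite mulr_gt0.
- by rewrite gtr_pMr.
- by rewrite addr_gt0// mulr_gt0// addr_gt0// invr_gt0.
move=> F V G L V0 G0 L0 FV FC; set N := _ + 1.
have N1 : 1 <= N by rewrite lerDr mulr_ge0 ?addr_ge0 ?invr_ge0// ltW.
have -> : (G `^ p^-1) `^ (p * b) = G `^ b.
  by rewrite -powRrM mulrA mulVf ?mul1r// gt_eqF.
have -> : (V `^ p^-1) `^ (p - p * b) = V `^ (1 - b).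
  have -> : p - p * b = p * (1 - b) by ring.
  by rewrite -powRrM mulrA mulVf ?mul1r// gt_eqF.
have RHS0 : 0 <= N * G `^ b * V `^ (1 - b).
  by rewrite !mulr_ge0 ?powR_ge0// (le_trans ler01 N1).
have [V_eq0|V_neq0] := eqVneq V 0.
  by apply: (le_trans FV); rewrite [leLHS]V_eq0 addr_ge0.
have {V_neq0}V0 : 0 < V by rewrite lt_neqAle eq_sym V_neq0.
(* When [G = 0] nothing is to be balanced: large [k] makes the decaying term smaller than any
   positive [F - L]. *)
have [G_eq0|G_neq0] := eqVneq G 0.
  apply: (@le_trans _ _ L); last by rewrite lerDr.
  rewrite leNgt; apply/negP => LF.
  have FL0 : 0 < F - L by rewrite subr_gt0.
  have [|k] := @exists_pow_lt _ kap (C * V) _ _ FL0; first by rewrite kap0.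
  have := FC k; rewrite G_eq0 mulr0 addr0 mulrCA; lra.
have {G_neq0}G0 : 0 < G by rewrite lt_neqAle eq_sym G_neq0.
pose t := G / V; have t0 : 0 < t by rewrite divr_gt0.
have tE : G `^ b * V `^ (1 - b) = t `^ b * V.
  rewrite powRB ?powRr1 ?ltW// ?gt_eqF ?implybT//.
  have iV0 : 0 <= V^-1 by rewrite invr_ge0 ltW.
  rewrite /t (powRM b (ltW G0) iV0).
  by rewrite -(powR_inv1 (ltW V0)) -powRrM mulN1r powRN; ring.
rewrite -mulrA tE.
have [t1|t1] := leP 1 t.
  apply: (le_trans FV); apply: ler_wpDr => //.
  have : 1 <= t `^ b by rewrite -(powRr0 t) ler_powR// ltW.
  by move=> tb1; rewrite mulrA ler_peMl ?mulr_ege1// ltW.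
pose y := t `^ (- 2^-1).
have y1 : 1 <= y.
  rewrite /y powRN invf_ge1 ?powR_gt0//.
  rewrite [leRHS](_ : 1 = 1 `^ 2^-1); last by rewrite powR1.
  by apply: ge0_ler_powR; rewrite ?nnegrE// ltW.
have y0 : 0 < y by exact: lt_le_trans ltr01 y1.
have [k /andP[ky yk]] := exists_pow_between A1 y1.
have t01 : 0 < t <= 1 by rewrite t0 ltW.
have h1 : A ^+ k * t <= t `^ b.
  apply: (@le_trans _ _ (t `^ 2^-1)); last by apply: ger_powR; rewrite ?ge_min ?lexx ?orbT.
  rewrite -(ler_pdivlMr _ _ t0); apply: (le_trans ky).
  rewrite /y -{3}(powRr1 (ltW t0)) -powRB; last by rewrite (gt_eqF t0) implybT.
  by apply: ger_powR => //; lra.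
(* The bound [y < A ^+ k.+1] controls the power [k.+1] of [kap']; returning to [k] costs the factor
   [1 / kap']. *)
have h2 : kap ^+ k <= t `^ b / kap'.
  apply: (@le_trans _ _ (kap' ^+ k)).
    by apply: lerXn2r; rewrite ?nnegrE ?(ltW kap'0)// le_max lexx.
  rewrite ler_pdivlMr// -exprSr kapE -powR_mulrn ?powR_ge0// powRAC (powR_mulrn _ (ltW A0)).
  apply: (@le_trans _ _ (y `^ (- sig))).
    rewrite !powRN lef_pV2 ?posrE ?powR_gt0 ?exprn_gt0//.
    apply: ge0_ler_powR; rewrite ?nnegrE ?(ltW sig0) ?(ltW yk) ?(le_trans ler01 y1)//.
    by rewrite exprn_ge0// ltW.
  rewrite /y -powRrM; apply: ger_powR => //.
  by rewrite mulrNN mulrC ge_min lexx.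
apply: (le_trans (FC k)); rewrite lerD2r.
have -> : G = t * V by rewrite /t divfK// gt_eqF.
have -> : C * (kap ^+ k * V + A ^+ k * (t * V)) = C * V * (kap ^+ k + A ^+ k * t).
  by ring.
apply: (@le_trans _ _ (C * V * (t `^ b / kap' + t `^ b))).
  by rewrite ler_wpM2l ?lerD// mulr_ge0// ltW.
rewrite /N (_ : C * V * _ = (C * (kap'^-1 + 1)) * (t `^ b * V)); last by ring.
apply: ler_wpM2r; last by rewrite lerDl.
by rewrite mulr_ge0 ?powR_ge0// ltW.
Qed.

(** * The level-set estimate for an [A_q] weight on dyadic cubes *)

Section MainBound.
Context {R : realType} {d : measure_display} {T : measurableType d}.
Variables (K1 K2 delta eps0 N0 p q K0 : R) (rho : T -> T -> R).
Variables (mu : {measure set T -> \bar R}) (C : int -> set (set T)).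
Variables w f g v : T -> R.
Hypotheses (ht : homogeneous_type K1 K2 rho mu).
Hypotheses (df : dyadic_filtration delta eps0 N0 rho mu C).
Hypotheses (delta01 : 0 < delta < 1) (eps0_gt0 : 0 < eps0).
Hypotheses (p1 : 1 < p) (q1 : 1 < q).
Hypotheses (wA : Ap_weight rho mu q w) (wK : (Ap_const rho mu q w <= K0%:E)%E).
Hypotheses (mf : measurable_fun setT f) (mg : measurable_fun setT g).
Hypotheses (mv : measurable_fun setT v) (voo : (wint mu w p v < +oo)%E).
Hypothesis fv : forall x, `|f x| <= v x.
Hypothesis osc : forall (n : int) (Q : set T), C n Q ->
  exists fQ : T -> R,
    [/\ measurable_fun Q fQ,
        mu.-integrable Q (EFin \o fQ),
        (forall x, Q x -> `|f x| <= fQ x <= v x) &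
        (forall y, Q y ->
           average mu Q (fun x => `|fQ x - average mu Q fQ|) <= g y)].

(** The constant of [Ap_lower] for [theta = 1 / (2 * (D * D))]: a factor [D] leads from a ball to
    the cube inside it, and [2 * D] from the cube to its subset. The maximum ensures [c >= 1]. *)
Definition weight_doubling (D : R) : R := Num.max 1 ((4 * (D * D)) `^ q * K0).

Let D := cube_doubling K2 delta eps0 N0.
Let c := weight_doubling D.

Let mw : measurable_fun setT w. Proof. by case: wA. Qed.
Let w0 x : 0 <= w x. Proof. by case: wA. Qed.
Let D1 : 1 <= D. Proof. exact: cube_doubling_ge1. Qed.
Let D0 : 0 < D. Proof. exact: lt_le_trans ltr01 D1. Qed.
Let c1 : 1 <= c. Proof. by rewrite le_max lexx. Qed.
Let v0 x : 0 <= v x. Proof. exact: le_trans (normr_ge0 _) (fv x). Qed.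
Let grid : dyadic_grid mu D C. Proof. exact: (dyadic_filtration_grid ht df delta01 eps0_gt0). Qed.

Let mwD E : measurable E -> measurable_fun E (EFin \o w).
Proof. by move=> mE; apply/measurable_EFinP; exact: measurable_funTS. Qed.

Let weight_lower n Q E : C n Q -> measurable E -> E `<=` Q ->
  (mu Q <= (2 * D)%:E * mu E)%E -> (wmeas mu w Q <= c%:E * wmeas mu w E)%E.
Proof.
move=> CQ mE EQ QE; have [z Qz zQ] := cube_qball ht df delta01 eps0_gt0 CQ.
have r0 : 0 < cube_radius delta eps0 N0 n by exact: cube_radius_gt0.
have QB := cube_sub_qball df delta01 eps0_gt0 CQ Qz.
have mB := measurable_qball ht z r0; have mQ := dg_measurable grid CQ.
have th0 : 0 < (2 * (D * D))^-1 by rewrite invr_gt0 !mulr_gt0.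
have := @Ap_lower _ _ _ K1 K2 q K0 rho mu w ht q1 wA wK z _ _ E r0 th0 mE
  (subset_trans EQ QB).
move=> /(_ _)/wrap[|h].
  rewrite -(@lee_pmul2l _ (2 * (D * D))%:E) ?lte_fin ?mulr_gt0//.
  rewrite muleA -EFinM divff ?gt_eqF ?mulr_gt0// mul1e.
  apply: (le_trans zQ); rewrite (_ : 2 * (D * D) = D * (2 * D)); last by ring.
  by rewrite EFinM -muleA; apply: lee_wpmul2l => //; rewrite lee_fin ltW.
apply: (@le_trans _ _ (wmeas mu w (qball rho z (cube_radius delta eps0 N0 n)%:E))).
  by apply: ge0_subset_integral => //; [exact: mwD|move=> x _; rewrite lee_fin].
apply: (le_trans h); apply: lee_wpmul2r.
  by apply: integral_ge0 => x _; rewrite lee_fin.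
rewrite lee_fin /c /weight_doubling le_max.
have -> : 2 / (2 * (D * D))^-1 = 4 * (D * D) by rewrite invrK; ring.
by rewrite lexx orbT.
Qed.

Let weight_lty n Q : C n Q -> (wmeas mu w Q < +oo)%E.
Proof.
move=> CQ; have [z Qz _] := cube_qball ht df delta01 eps0_gt0 CQ.
have r0 : 0 < cube_radius delta eps0 N0 n by exact: cube_radius_gt0.
apply: le_lt_trans (Ap_qball_lty ht q1 wA wK z r0).
have mB := measurable_qball ht z r0.
apply: ge0_subset_integral => //.
- exact: (dg_measurable grid CQ).
- exact: mwD.
- by move=> x _; rewrite lee_fin.
- exact: (cube_sub_qball df delta01 eps0_gt0 CQ Qz).
Qed.

(** Levels from [l0] on satisfy the good-lambda inequality; below [l0], where [v > l / 4] may hold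
    on more than half of a finite space, the crude bound [M] stands in. The factor
    [32 * (2 * D) ^+ k] is [2 / gam]. *)
Lemma main_bound (k : nat) (l0 : R) (M : \bar R) : 0 <= l0 -> (0 <= M)%E ->
  (forall l, 0 < l -> l < l0 -> (wmeas mu w [set x | (l < `|f x|)%R] <= M)%E) ->
  (forall l, 0 < l -> l0 <= l -> (mu setT < +oo)%E ->
     (2%:E * mu [set x | (l / 4 < v x)%R] <= mu setT)%E) ->
  (wint mu w p f <= (2 `^ p)%:E *
     (((decay c ^+ k * c) * 8 `^ p)%:E * wint mu w p v +
      ((32 * (2 * D) ^+ k) `^ p)%:E * wint mu w p g + ((2 * l0) `^ p)%:E * M))%E.
Proof.
move=> l00 M0 lowM half; have [om omE] := exists_density_measure mu mw w0.
have P0 : 0 < (2 * D) ^+ k by rewrite exprn_gt0// mulr_gt0.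
have -> : 32 * (2 * D) ^+ k = 2 / ((2 * D) ^+ k * 16)^-1 by rewrite invrK; ring.
have vabs (l : R) : [set x | l < `|v x|] = [set x | l < v x].
  by apply/seteqP; split => x /=; rewrite ger0_norm.
apply: (layer_bound p1 mw w0 omE) => //.
- by rewrite mulr_ge0 ?exprn_ge0 ?decay_ge0// (le_trans ler01 c1).
- by rewrite invr_gt0 mulr_gt0.
move=> l lgt0; rewrite vabs; have [ll0|l0l] := ltP l l0.
  rewrite -[leLHS]add0e; apply: leeD.
    by rewrite adde_ge0// mule_ge0// lee_fin mulr_ge0 ?exprn_ge0 ?decay_ge0// (le_trans ler01 c1).
  by rewrite omE; exact: lowM.
rewrite adde0; apply: (good_lambda grid D1 c1) => //.
- by move=> S mS S0; rewrite omE; apply: null_set_integral => //; exact: mwD.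
- by move=> n Q E CQ mE EQ QE; rewrite !omE; exact: (weight_lower CQ).
- move=> n Q CQ; rewrite omE; apply: (Ap_weight_gt0 wA).
    exact: (dg_measurable grid CQ).
  exact: (dg_gt0 grid CQ).
- by move=> n Q CQ; rewrite omE; exact: (weight_lty CQ).
- by move=> n Q /osc[fQ [_ ? ? ?]]; exists fQ.
(* A layer sum with the single level [l] is Chebyshev's inequality, which shows that [v > l / 4] has
   finite weight. *)
- have i4 : 0 < 4^-1 :> R by rewrite invr_gt0.
  have := sum_measure_level_le p1 mw w0 omE 1 mv lgt0 i4.
  rewrite big_ord1 /level expr0 mul1r vabs [4^-1 * l]mulrC => h.
  have {h} : ((l `^ p)%:E * om [set x | (l / 4 < v x)%R] < +oo)%E.
    by apply: (le_lt_trans h); rewrite lte_mul_pinfty// lee_fin powR_ge0.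
  have lp0 : 0 < l `^ p by rewrite powR_gt0.
  by case: (om _) => // [r|]; rewrite ?ltry// gt0_muley ?lte_fin.
- exact: half.
Qed.

End MainBound.

(** * Passage to norms and the final estimates *)

Lemma wnorm_powR {d} {T : measurableType d} {R : realType}
    (mu : {measure set T -> \bar R}) (w : T -> R) (p : R) (u : T -> R) :
  0 < p -> (forall x, 0 <= w x) -> (wnorm mu w p u `^ p)%E = wint mu w p u.
Proof.
move=> p0 w0; rewrite /wnorm -poweRrM mulVf ?gt_eqF// poweRe1//.
exact: wint_ge0.
Qed.

Lemma wLp_wint {d} {T : measurableType d} {R : realType}
    (mu : {measure set T -> \bar R}) (w : T -> R) (p : R) (u : T -> R) :
  0 < p -> (forall x, 0 <= w x) -> wLp mu w p u ->
  exists2 U : R, 0 <= U & wint mu w p u = U%:E.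
Proof.
move=> p0 w0 [_]; have := wint_ge0 mu p w0 u; rewrite /wnorm -/(wint mu w p u).
case: (wint mu w p u) => [U||]//; first by exists U.
by rewrite poweRyr ?ltxx// invr_eq0 gt_eqF.
Qed.

Lemma sub_qclosure {R : realType} {T : Type} (rho : T -> T -> R) (A : set T) :
  A `<=` qclosure rho A.
Proof. by move=> x Ax U _ Ux; exists x. Qed.

(** The parameters of the cubes are functions of [K1] and [K2], and [beta] and [N] are chosen before
    the space, the cubes, the weight and the functions; this expresses the claimed dependence of the
    constants. *)
Theorem theorem2p4 (R : realType) (delta eps0 N0 : R -> R -> R)
    (K1 K2 p q K0 : R)
    (hdelta : 0 < delta K1 K2 < 1) (heps0 : 0 < eps0 K1 K2)
    (hp : 1 < p) (hq : 1 < q) (hK0 : 1 <= K0) :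
  exists beta N : R, 0 < beta /\ 0 < N /\
  forall (d : measure_display) (T : measurableType d) (rho : T -> T -> R)
    (mu : {measure set T -> \bar R}) (C : int -> set (set T)),
  homogeneous_type K1 K2 rho mu ->
  dyadic_filtration (delta K1 K2) (eps0 K1 K2) (N0 K1 K2) rho mu C ->
  forall w f g v : T -> R,
  Ap_weight rho mu q w -> (Ap_const rho mu q w <= K0%:E)%E ->
  wLp mu w p f -> wLp mu w p g -> wLp mu w p v ->
  (forall x, `|f x| <= v x) ->
  (forall (n : int) (Q : set T), C n Q ->
     exists fQ : T -> R,
       [/\ measurable_fun Q fQ,
           mu.-integrable Q (EFin \o fQ),
           (forall x, Q x -> `|f x| <= fQ x <= v x) &
           (forall y, Q y ->
              average mu Q (fun x => `|fQ x - average mu Q fQ|) <= g y)]) ->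
  ((mu setT < +oo)%E ->
     (wnorm mu w p f `^ p <=
        N%:E * wnorm mu w p g `^ beta * wnorm mu w p v `^ (p - beta)
        + N%:E * mu setT `^ (- p) * wmeas mu w (qsupp rho v)
          * 'N[mu]_1[EFin \o v] `^ p)%E
     /\
     (forall (eps : R) (x0 : T) (r0 : \bar R),
        0 < eps -> (0 < r0)%E ->
        qsupp rho v `<=` qball rho x0 r0 ->
        (mu (qball rho x0 r0) <= eps%:E * mu setT)%E ->
        (wnorm mu w p f `^ p <=
           N%:E * wnorm mu w p g `^ beta * wnorm mu w p v `^ (p - beta)
           + (N * eps `^ p)%:E * wnorm mu w p v `^ p)%E))
  /\
  ((mu setT = +oo)%E ->
     (wnorm mu w p f `^ p <=
        N%:E * wnorm mu w p g `^ beta * wnorm mu w p v `^ (p - beta))%E).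
Proof.
set D := cube_doubling K2 (delta K1 K2) (eps0 K1 K2) (N0 K1 K2).
set c := weight_doubling q K0 D.
have p0 : 0 < p by exact: lt_trans hp.
have D1 : 1 <= D by exact: cube_doubling_ge1.
have c1 : 1 <= c by rewrite le_max lexx.
have c0 : 0 < c by exact: lt_le_trans ltr01 _.
have D2 : 1 < 2 * D by lra.
have A1 : 1 < (2 * D) `^ p by apply: (lt_le_trans D2); apply: le1r_powR; exact: ltW.
have k01 : 0 <= decay c < 1 by rewrite decay_ge0// decay_lt1.
(* [C0] collects the [k]-independent constants of [main_bound], whose growing factor has base
   [(2 * D) ^ p]. *)
pose C0 := 2 `^ p * (c * 8 `^ p + 32 `^ p).
have C00 : 0 < C0 by rewrite mulr_gt0 ?powR_gt0// addr_gt0 ?mulr_gt0 ?powR_gt0.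
have [b [N [b0 bp N0' opt]]] := optimize_decay A1 k01 p0 C00.
(* [32 `^ p] accounts for the levels below [8 ||v||_1 / mu X], and [2 `^ p] for
   the trivial case [eps > 1 / 2]. *)
exists b, (N + 32 `^ p + 2 `^ p); split => //; split.
  by rewrite !addr_gt0 ?powR_gt0.
move=> d T rho mu C ht df w f g v wA wK Lf Lg Lv fv osc.
have w0 : forall x, 0 <= w x by case: wA.
have mw : measurable_fun setT w by case: wA.
have [mf _] := Lf; have [mg _] := Lg; have [mv _] := Lv.
have [F F0 FE] := wLp_wint p0 w0 Lf; have [G G0 GE] := wLp_wint p0 w0 Lg.
have [V V0 VE] := wLp_wint p0 w0 Lv.
have v0 x : 0 <= v x by exact: le_trans (normr_ge0 _) (fv x).
have FV : F <= V.
  rewrite -lee_fin -FE -VE; apply: ge0_le_integral => //.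
  - by move=> x _; rewrite lee_fin mulr_ge0 ?powR_ge0.
  - by apply/measurable_EFinP; exact: measurable_wint.
  - by apply/measurable_EFinP; exact: measurable_wint.
  - move=> x _; rewrite lee_fin ler_wpM2r//; apply: ge0_ler_powR.
    + exact: ltW.
    + by rewrite nnegrE.
    + by rewrite nnegrE.
    + by rewrite (ger0_norm (v0 x)).
set B := (_ * wnorm mu w p g `^ b * wnorm mu w p v `^ (p - b))%E.
have B0 : (0 <= B)%E.
  by rewrite /B !mule_ge0 ?poweR_ge0// lee_fin !addr_ge0 ?powR_ge0// ltW.
(* Common to all cases: [main_bound] for every [k], followed by the optimization. [L] is the
   contribution of the exceptional levels. *)
have step (l0 : R) (M : \bar R) (L : R) : 0 <= l0 -> (0 <= M)%E ->
    (forall l, 0 < l -> l < l0 -> (wmeas mu w [set x | (l < `|f x|)%R] <= M)%E) ->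
    (forall l, 0 < l -> l0 <= l -> (mu setT < +oo)%E ->
       (2%:E * mu [set x | (l / 4 < v x)%R] <= mu setT)%E) ->
    0 <= L -> ((2 `^ p)%:E * (((2 * l0) `^ p)%:E * M) = L%:E)%E ->
    (wnorm mu w p f `^ p <= B + L%:E)%E.
  move=> l00 M0 lowM half L0 LE; rewrite wnorm_powR// FE.
  have key (k : nat) : F <= C0 * (decay c ^+ k * V + ((2 * D) `^ p) ^+ k * G) + L.
    have voo : (wint mu w p v < +oo)%E by rewrite VE ltry.
    have dk0 : 0 <= decay c ^+ k by rewrite exprn_ge0//; case/andP: k01.
    have := main_bound ht df hdelta heps0 hp hq wA wK mf mg mv voo fv osc k
      l00 M0 lowM half.
    rewrite FE VE GE ge0_muleDr; last 2 first.
    - by rewrite adde_ge0// mule_ge0// lee_fin ?powR_ge0// !mulr_ge0 ?powR_ge0 ?dk0// ltW.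
    - by rewrite mule_ge0// lee_fin powR_ge0.
    rewrite LE -(EFinM _ V) -(EFinM _ G) -EFinD lee_fin -/D -/c => h.
    apply: (le_trans h); rewrite lerD2r.
    have -> : (32 * (2 * D) ^+ k) `^ p = 32 `^ p * ((2 * D) `^ p) ^+ k.
      rewrite powRM ?exprn_ge0//; last by rewrite ltW// (lt_trans ltr01).
      congr (_ * _); have D20 : 0 <= 2 * D by rewrite ltW// (lt_trans ltr01).
      by rewrite -(powR_mulrn _ D20) powRAC powR_mulrn ?powR_ge0.
    have X0 : 0 <= decay c ^+ k * V.
      by rewrite mulr_ge0 ?exprn_ge0//; case/andP: k01.
    have Y0 : 0 <= ((2 * D) `^ p) ^+ k * G by rewrite mulr_ge0 ?exprn_ge0 ?powR_ge0.
    rewrite /C0 -[leRHS]mulrA; apply: ler_wpM2l; first exact: powR_ge0.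
    have e1 : 0 <= 8 `^ p :> R by exact: powR_ge0.
    have e2 : 0 <= 32 `^ p :> R by exact: powR_ge0.
    set X := decay c ^+ k * V in X0 *; set Y := _ ^+ k * G in Y0 *.
    have -> : decay c ^+ k * c * 8 `^ p * V + 32 `^ p * (2 * D) `^ p ^+ k * G =
       c * 8 `^ p * X + 32 `^ p * Y by rewrite /X /Y; ring.
    rewrite mulrDr !mulrDl.
    have q1 : 0 <= 32 `^ p * X by rewrite mulr_ge0.
    have q2 : 0 <= c * 8 `^ p * Y by rewrite mulr_ge0// mulr_ge0// ltW.
    by move: q1 q2; lra.
  have := opt _ _ _ _ V0 G0 L0 FV key.
  rewrite /B /wnorm -!/(wint mu w p _) GE VE !poweR_EFin -EFinM -EFinD lee_fin.
  move=> h; apply: (le_trans h); rewrite lerD2r ler_wpM2r ?powR_ge0//.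
  by rewrite ler_wpM2r ?powR_ge0// -addrA lerDl addr_ge0 ?powR_ge0.
split; last first.
  (* In infinite measure no level is exceptional, so [l0 = 0]. *)
  move=> Xoo; rewrite -[leRHS]adde0; apply: (step 0 0%E 0) => //.
  - by move=> l l0 /(lt_trans l0); rewrite ltxx.
  - by rewrite Xoo.
  - by rewrite !mule0.
move=> Xoo.
have Xfin : mu setT \is a fin_num by rewrite ge0_fin_numE.
have mvl (l : R) : measurable [set x | l < v x] by exact: measurable_superlevel.
set S := qsupp rho v; have mS : measurable S by exact: (qclosure_measurable ht).
have subS (l : R) : 0 < l -> [set x | l < v x] `<=` S.
  by move=> l0 x lv; apply: sub_qclosure; rewrite /= gt_eqF// (lt_trans l0).
split; last first.
  move=> eps x0 r0 eps0' r0_gt0 SB Bmu.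
  (* For [eps <= 1 / 2] the support of [v] has at most half the measure of [X], and again no level
     is exceptional. For larger [eps], [1 <= (2 * eps) ^ p] and [F <= V] suffice. *)
  have [eps2|eps2] := leP eps 2^-1.
    have mB : measurable (qball rho x0 r0).
      case: r0 r0_gt0 {SB Bmu} => [r||]// r_gt0; first exact: (measurable_qball ht).
      by rewrite (_ : qball _ _ _ = setT)//; apply/seteqP; split => // y _; exact: ltry.
    apply: (@le_trans _ _ (B + 0)%E).
      apply: (step 0 0%E 0) => //; last by rewrite !mule0.
        by move=> l l0 /(lt_trans l0); rewrite ltxx.
      move=> l l0 _ _; apply: (@le_trans _ _ (2%:E * (eps%:E * mu setT))%E).
        apply: lee_wpmul2l => //; apply: le_trans Bmu.
        apply: le_measure; rewrite ?inE//.
        by apply: subset_trans SB; apply: subS; rewrite divr_gt0.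
      rewrite muleA -EFinM -[leRHS]mul1e; apply: lee_wpmul2r => //.
      by rewrite lee_fin mulrC -ler_pdivlMr// div1r.
    apply: leeD => //; apply: mule_ge0; rewrite ?poweR_ge0// lee_fin.
    by rewrite mulr_ge0 ?powR_ge0// !addr_ge0 ?powR_ge0// ltW.
  rewrite !wnorm_powR// FE VE -[leLHS]add0e; apply: leeD => //.
  rewrite -EFinM lee_fin; apply: (le_trans FV).
  have e1 : 1 <= 2 `^ p * eps `^ p.
    rewrite -powRM// ?(ltW eps0')// -[leLHS](powRr0 (2 * eps)).
    apply: ler_powR; last exact: ltW.
    by rewrite mulrC -ler_pdivrMr// div1r ltW.
  have e2 : 2 `^ p * eps `^ p <= (N + 32 `^ p + 2 `^ p) * eps `^ p.
    by rewrite ler_wpM2r ?powR_ge0// lerDr addr_ge0 ?powR_ge0// ltW.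
  by rewrite ler_peMl// (le_trans e1).
set L1 := ('N[mu]_1[EFin \o v])%E.
have L1E : L1 = (\int[mu]_x (v x)%:E)%E.
  by rewrite /L1 Lnorm1; apply: eq_integral => x _ /=; rewrite ger0_norm.
have L1_ge0 : (0 <= L1)%E by rewrite L1E; apply: integral_ge0 => x _; rewrite lee_fin.
have X0 : (0 < mu setT)%E.
  apply: lt_le_trans (measure_qball_gt0 ht point ltr01) _.
  by apply: le_measure; rewrite ?inE//; exact: (measurable_qball ht).
have m0 : 0 < fine (mu setT) by rewrite fine_gt0// X0.
set m := fine (mu setT) in m0; have mE : mu setT = m%:E by rewrite fineK.
set N' := N + 32 `^ p + 2 `^ p.
have N'0 : 0 < N' by rewrite !addr_gt0 ?powR_gt0.
set M := wmeas mu w S; have M_ge0 : (0 <= M)%E.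
  by apply: integral_ge0 => x _; rewrite lee_fin.
rewrite mE poweR_EFin -EFinM; set K := N' * m `^ (- p).
have K_gt0 : 0 < K by rewrite mulr_gt0// powR_gt0.
(* Because [0 * +oo = 0], the cases [M = 0] and [L1 = 0] must hold without the last term; in both,
   [v] vanishes almost everywhere. *)
have triv : (forall l, 0 < l -> mu [set x | (l / 4 < v x)%R] = 0%E) ->
    (wnorm mu w p f `^ p <= B + K%:E * M * L1 `^ p)%E.
  move=> null; apply: (@le_trans _ _ (B + 0)%E).
    apply: (step 0 0%E 0) => //; last by rewrite !mule0.
      by move=> l l0 /(lt_trans l0); rewrite ltxx.
    by move=> l l0 _ _; rewrite null// mule0.
  apply: leeD => //; rewrite mule_ge0 ?poweR_ge0// mule_ge0// lee_fin.
  exact: ltW.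
have cheb (l : R) : 0 < l -> ((l / 4)%:E * mu [set x | (l / 4 < v x)%R] <= L1)%E.
  move=> l0; rewrite L1E; apply: mul_measure_le_integral => //.
  - by rewrite divr_ge0// ltW.
  - by move=> x /ltW.
have [M0|M_neq0] := eqVneq M 0%E.
  apply: triv => l l0; apply/eqP; rewrite -measure_le0.
  have muS : mu S = 0%E.
    apply/eqP; rewrite -measure_le0 leNgt; apply/negP => S0.
    by have := Ap_weight_gt0 wA mS S0; rewrite -/(wmeas mu w S) -/M M0 ltxx.
  by rewrite -muS; apply: le_measure; rewrite ?inE//; apply: subS; rewrite divr_gt0.
have {M_neq0 M_ge0}M_gt0 : (0 < M)%E by rewrite lt_neqAle eq_sym M_neq0.
have KM_gt0 : (0 < K%:E * M)%E by rewrite mule_gt0.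
case L1l : L1 L1_ge0 => [l1||]// l1_ge0; last first.
  by rewrite poweRyr ?gt_eqF// gt0_muley// addey ?leey// -ltNye (lt_le_trans _ B0).
rewrite lee_fin in l1_ge0; have [l1_eq0|l1_neq0] := eqVneq l1 0.
  rewrite -L1l; apply: triv => l l0; apply/eqP; rewrite -measure_le0.
  have := cheb _ l0; rewrite L1l l1_eq0 => h.
  have l40 : 0 < l / 4 by rewrite divr_gt0.
  by rewrite -(@lee_pmul2l _ (l / 4)%:E) ?lte_fin// mule0.
have {l1_neq0 l1_ge0}l1_gt0 : 0 < l1 by rewrite lt_neqAle eq_sym l1_neq0.
rewrite poweR_EFin; have lp0 : 0 < l1 `^ p by rewrite powR_gt0.
have : (M <= +oo)%E by exact: leey.
rewrite le_eqVlt => /predU1P[My|Moo].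
  rewrite My gt0_muley ?lte_fin// gt0_mulye ?lte_fin//.
  by rewrite addey ?leey// -ltNye (lt_le_trans _ B0).
have Mfin : M \is a fin_num by rewrite ge0_fin_numE// ltW.
have fM0 : 0 <= fine M by rewrite fine_ge0// ltW.
(* For [l >= 8 * l1 / m], Chebyshev bounds the measure of [v > l / 4] by [4 * l1 / l <= m / 2]. At
   smaller levels, [|f| > l] is contained in the support of [v], of weight [M]. *)
pose l0 := 8 * l1 / m; have l0_gt0 : 0 < l0 by rewrite divr_gt0// mulr_gt0.
apply: (@le_trans _ _ (B + (2 `^ p * ((2 * l0) `^ p * fine M))%:E)%E).
  apply: (step l0 M).
  - exact: ltW.
  - exact: ltW.
  - move=> l lgt0 _; apply: ge0_subset_integral => //.
    + by apply: measurable_superlevel; exact: measurableT_comp.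
    + by apply/measurable_EFinP; exact: measurable_funTS.
    + by move=> x _; rewrite lee_fin.
    + by move=> x /= lf; apply: (subS _ lgt0); exact: lt_le_trans (fv x).
  - move=> l lgt0 ll0 _; have := cheb _ lgt0; rewrite L1l mE.
    have l40 : 0 < l / 4 by rewrite divr_gt0.
    have Afin : mu [set x | l / 4 < v x] \is a fin_num.
      by rewrite ge0_fin_numE// (le_lt_trans (le_measure mu _ _ (@subsetT _ _))) ?inE.
    rewrite -(fineK Afin) -!EFinM !lee_fin => h.
    have := ll0; rewrite /l0 ler_pdivrMr// => h2.
    rewrite -(@ler_pM2l _ (l / 4))//.
    by move: h h2; lra.
  - by rewrite !mulr_ge0 ?powR_ge0.
  - by rewrite -{1}(fineK Mfin) -!EFinM.
apply: leeD => //; rewrite -(fineK Mfin) -!EFinM lee_fin /K.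
(* The constant is [2 * (2 * 8) = 32], raised to the power [p]. *)
have -> : 2 `^ p * ((2 * l0) `^ p * fine M) = 32 `^ p * m `^ (- p) * fine M * l1 `^ p.
  have i0 : 0 <= m^-1 by rewrite invr_ge0 ltW.
  have -> : 2 * l0 = 16 * l1 * m^-1 by rewrite /l0; ring.
  rewrite (powRM _ _ i0); last by rewrite mulr_ge0// ltW.
  rewrite (powRM _ _ (ltW l1_gt0))//.
  have -> : 32 = 2 * 16 :> R by ring.
  rewrite (@powRM _ 2 16)// -(powR_inv1 (ltW m0)) -powRrM mulN1r; ring.
rewrite ler_wpM2r ?(ltW lp0)// ler_wpM2r// ler_wpM2r ?powR_ge0//.
by rewrite /N' addrAC lerDr addr_ge0 ?powR_ge0// ltW.
Qed.
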